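(* Let $q$ be a bounded real-valued measurable potential on $\mathbb R_+$, $\alpha\in\mathbb R\cup\{\infty\}$, and let $\sigma$ be the scalar spectral measure of the corresponding self-adjoint Schrödinger operator $Hf=-f''+qf$ on $L^2(\mathbb R_+)$ with boundary condition $f'(0)+\alpha f(0)=0$. For a constant $\omega\in\mathbb R$, let $(\nu,\psi)$ be the spectral pair of the Schrödinger operator $H+\mathrm i\omega I$, corresponding to the potential $q+\mathrm i\omega$ and the boundary parameter $\alpha$. Then $\nu$ is supported on $(-\infty,-|\omega|]\cup[|\omega|,\infty)$ and the spectral pair $(\nu,\psi)$ can be determined from the formulas $$d\nu(s)=\frac12\bigl(d\sigma(\lambda)+d\sigma_*(\lambda)\bigr),$$ $$\psi(s)\,d\nu(s)=\frac{\lambda+\mathrm i\omega}{2s}\,d\sigma(\lambda)-\frac{\lambda-\mathrm i\omega}{2s}\,d\sigma_*(\lambda),$$ where $\lambda\geq0$ and $s\geq|\omega|$ are related by $s^2=\lambda^2+\omega^2$.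
   Context: Notation: $\mathbb R_+=(0,\infty)$, $\epsilon=\begin{pmatrix}0&1\\1&0\end{pmatrix}$, $I$ is the identity, and $\operatorname{Re}M=\frac12(M+M^* )$ for a matrix $M$. For $\alpha=\infty$ the boundary condition $f'(0)+\alpha f(0)=0$ means $f(0)=0$; operator domains consist of $f\in W^{2,2}([0,\infty))$ satisfying the boundary condition. For a scalar measure $\sigma$ on $\mathbb R$, $\sigma_*$ is the reflected measure corresponding to the change of variable $x\mapsto-x$, i.e. $\sigma_*([a,b])=\sigma([-b,-a])$. The formulas are identities of measures under the change of variable $s=\sqrt{\lambda^2+\omega^2}$ from $\lambda\in[0,\infty)$ to $s\in[|\omega|,\infty)$. Scalar spectral measure: let $\gamma\in[0,\pi)$ be given by $\sin\gamma=\frac1{\sqrt{1+\alpha^2}}$, $\cos\gamma=\frac\alpha{\sqrt{1+\alpha^2}}$ ($\gamma=0$ if $\alpha=\infty$). Let $\varphi,\theta$ be the solutions of $-f''+qf=\lambda f$ with $\varphi(0,\lambda)=\sin\gamma$, $\varphi'(0,\lambda)=-\cos\gamma$, $\theta(0,\lambda)=\cos\gamma$, $\theta'(0,\lambda)=\sin\gamma$. For $\lambda\in\mathbb C\setminus\mathbb R$, $m_\alpha(\lambda)$ is the unique complex number such that $\theta(\cdot,\lambda)-\varphi(\cdot,\lambda)m_\alpha(\lambda)\in L^2(\mathbb R_+)$; it is a Herglotz–Nevanlinna function and $m_\alpha(\lambda)=\operatorname{Re}m_\alpha(\mathrm i)+\int_{\mathbb R}\bigl(\frac1{t-\lambda}-\frac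 t{1+t^2}\bigr)d\sigma(t)$ with a unique positive measure $\sigma$, the spectral measure of $H$. Spectral pair of a Schrödinger operator with bounded complex potential $p$ and boundary parameter $\alpha\in\mathbb C\cup\{\infty\}$ (here $p=q+\mathrm i\omega$): let $Q=\begin{pmatrix}0&p\\\overline p&0\end{pmatrix}$, $A=\begin{pmatrix}\overline\alpha&0\\0&\alpha\end{pmatrix}$; put $S=\frac{1}{\sqrt{1+|\alpha|^2}}I$, $C=\frac1{\sqrt{1+|\alpha|^2}}\epsilon A$ if $\alpha\in\mathbb C$, and $S=0$, $C=\epsilon$ if $\alpha=\infty$. For $z\in\mathbb C$ let $\Phi(x,z),\Theta(x,z)$ be the $2\times2$ matrix solutions of $-\epsilon F''+QF=zF$, $x>0$, with $\Phi(0,z)=S$, $\epsilon\Phi'(0,z)=-C$, $\Theta(0,z)=C$, $\epsilon\Theta'(0,z)=S$. For $z\in\mathbb C\setminus\mathbb R$, $M_\alpha(z)$ is the unique $2\times2$ matrix such that both columns of $\Theta(x,z)-\Phi(x,z)M_\alpha(z)$ belong to $L^2(\mathbb R_+;\mathbb C^2)$ as functions of $x$. One has $$M_\alpha(z)=\operatorname{Re}M_\alpha(\mathrm i)+\int_{-\infty}^\infty\Bigl(\frac1{t-z}-\frac t{1+t^2}\Bigr)\,d\Sigma(t),\qquad z\in\mathbb C\setminus\mathbb R,$$ with a unique (positive semi-definite) $2\times2$ matrix-valued measure $\Sigma$ on $\mathbb R$ such that $\int_{\mathbb R}\frac{d\Sigma(t)}{1+t^2}$ converges. There exist a unique even positive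 measure $\nu$ on $\mathbb R$ and a unique odd complex-valued $\psi\in L^\infty(\nu)$ with $|\psi|\le1$ $\nu$-a.e. such that $d\Sigma=\begin{pmatrix}1&\psi\\\overline\psi&1\end{pmatrix}d\nu$; $(\nu,\psi)$ is the spectral pair. Since $\nu$ is even and $\psi$ is odd, both are determined by their restrictions to $[0,\infty)$.
   Formalization: If ω≠0 and σ({0})>0, the printed formulas fail at s=|ω| (e.g. q=1, α=1, ω=1: ν({1})=2, not 4), since the atom at λ=0 is counted via both σ and σ_*. They are proved for all Borel sets avoiding this case; at s=|ω|, ω≠0, both right-hand sides are halved. *)

(* Defs.v *)
From HB Require Import structures.
From mathcomp Require Import all_boot all_order all_algebra.
From mathcomp Require Import all_classical all_reals all_analysis.
From mathcomp Require Import measurable_realfun.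
From mathcomp Require Export complex.

Set Implicit Arguments.
Unset Strict Implicit.
Unset Printing Implicit Defensive.

Import Order.TTheory GRing.Theory Num.Theory.
Import numFieldNormedType.Exports.

Local Open Scope classical_set_scope.
Local Open Scope ring_scope.
Local Open Scope complex_scope.

Section complex_integration.
Variable R : realType.
Notation TR := (measurableTypeR R).
Implicit Types (mu : {measure set TR -> \bar R}) (D : set R) (f : R -> R[i]).

Definition cmeasurable D f : Prop :=
  measurable_fun (D : set TR) (fun x => complex.Re (f x)) /\
  measurable_fun (D : set TR) (fun x => complex.Im (f x)).

Definition cintegrable mu D f : Prop :=
  mu.-integrable D (fun x => (complex.Re (f x))%:E) /\
  mu.-integrable D (fun x => (complex.Im (f x))%:E).

(* Meaningful when [cintegrable mu D f]. *)
Definition cintegral mu D f : R[i] :=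
  (\int[mu]_(x in D) complex.Re (f x))%R
  +i* (\int[mu]_(x in D) complex.Im (f x))%R.

(* f is in L^2(R_+). *)
Definition L2 f : Prop :=
  cmeasurable `]0, +oo[ f /\
  (\int[lebesgue_measure]_(x in `]0%R, +oo[)
     (complex.Re (f x) ^+ 2 + complex.Im (f x) ^+ 2)%:E < +oo)%E.

(* On [0, oo), f is locally absolutely continuous with derivative g: it is an
   indefinite integral of the locally integrable function g. *)
Definition has_ac_derivative f g : Prop :=
  forall x : R, 0 <= x ->
    cintegrable lebesgue_measure `[0, x] g /\
    f x = f 0 + cintegral lebesgue_measure `[0, x] g.

End complex_integration.

Section reflection.
Variable R : realType.
Notation TR := (measurableTypeR R).

Definition reflected (sigma : {measure set TR -> \bar R}) : set TR -> \bar R :=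
  pushforward sigma (-%R : TR -> TR).

Variable sigma : {measure set TR -> \bar R}.

Let measurable_preimageN (A : set TR) :
  measurable A -> measurable ((-%R : TR -> TR) @^-1` A).
Proof.
move=> mA; rewrite -[X in measurable X]setTI.
exact: (measurable_funN (@measurable_id _ TR setT)).
Qed.

Let reflected0 : reflected sigma set0 = 0%E.
Proof. by rewrite /reflected /pushforward preimage_set0 measure0. Qed.

Let reflected_ge0 A : (0 <= reflected sigma A)%E.
Proof. exact: measure_ge0. Qed.

Let reflected_sigma_additive : semi_sigma_additive (reflected sigma).
Proof.
move=> F mF tF mUF; rewrite /reflected /pushforward preimage_bigcup.
apply: measure_semi_sigma_additive.
- by move=> n; exact: measurable_preimageN.
- apply/trivIsetP => /= i j _ _ ij; rewrite -preimage_setI.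
  by move/trivIsetP : tF => /(_ _ _ _ _ ij) ->//; rewrite preimage_set0.
- by rewrite -preimage_bigcup; exact: measurable_preimageN.
Qed.

HB.instance Definition _ := isMeasure.Build _ _ _ (reflected sigma)
  reflected0 reflected_ge0 reflected_sigma_additive.

End reflection.

Section herglotz.
Variable R : realType.

Definition herglotz_kernel (z : R[i]) (t : R) : R[i] :=
  (t%:C - z)^-1 - (t / (1 + t ^+ 2))%:C.

(* The integral of dmu(t) / (1 + t^2) converges. *)
Definition herglotz_measure
    (mu : {measure set (measurableTypeR R) -> \bar R}) : Prop :=
  (\int[mu]_(t in setT) ((1 + t ^+ 2)^-1)%:E < +oo)%E.

End herglotz.

(* In both settings below the boundary parameter is an option, [None] being
   the value infinity. *)

Section scalar.
Variable R : realType.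
Implicit Types (q : R -> R) (alpha : option R) (l : R[i]) (f : R -> R[i]).

(* f solves -f'' + q f = l f on R_+ (almost everywhere, f' being locally
   absolutely continuous), with f(0) = a and f'(0) = b. *)
Definition scalar_solution q l f (a b : R[i]) : Prop :=
  exists f1 f2 : R -> R[i],
    [/\ has_ac_derivative f f1, has_ac_derivative f1 f2,
        {ae lebesgue_measure, forall x : R, 0 < x ->
           - f2 x + (q x)%:C * f x = l * f x},
        f 0 = a & f1 0 = b].

Definition sin_gamma alpha : R :=
  if alpha is Some a then (Num.sqrt (1 + a ^+ 2))^-1 else 0.

Definition cos_gamma alpha : R :=
  if alpha is Some a then a / Num.sqrt (1 + a ^+ 2) else 1.

(* m is the value m_alpha(l). *)
Definition is_m_value q alpha l (m : R[i]) : Prop :=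
  exists phi theta : R -> R[i],
    [/\ scalar_solution q l phi (sin_gamma alpha)%:C (- cos_gamma alpha)%:C,
        scalar_solution q l theta (cos_gamma alpha)%:C (sin_gamma alpha)%:C &
        unique (fun c : R[i] => L2 (fun x => theta x - phi x * c)) m].

Definition is_spectral_measure q alpha
    (sigma : {measure set (measurableTypeR R) -> \bar R}) : Prop :=
  exists m : R[i] -> R[i],
    [/\ forall l, complex.Im l != 0 -> is_m_value q alpha l (m l),
        herglotz_measure sigma &
        forall l, complex.Im l != 0 ->
          m l = (complex.Re (m 'i))%:C
                + cintegral sigma setT (herglotz_kernel l)].

End scalar.

Section spectral_pair.
Variable R : realType.
Notation C := R[i].
Implicit Types (p : R -> C) (alpha : option C) (z : C) (F : R -> 'M[C]_2).

Definition mx22 (a b c d : C) : 'M[C]_2 :=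
  \matrix_(i, j) if i == 0 then (if j == 0 then a else b)
                 else (if j == 0 then c else d).

Definition epsilon : 'M[C]_2 := mx22 0 1 1 0.

Definition Remx (M : 'M[C]_2) : 'M[C]_2 :=
  2^-1 *: (M + (map_mx (fun c => c^*) M)^T).

Definition sqnormc (c : C) : R := complex.Re c ^+ 2 + complex.Im c ^+ 2.

Definition bc_S alpha : 'M[C]_2 :=
  if alpha is Some a then ((Num.sqrt (1 + sqnormc a))^-1)%:C%:M else 0.

Definition bc_C alpha : 'M[C]_2 :=
  if alpha is Some a
  then ((Num.sqrt (1 + sqnormc a))^-1)%:C *: (epsilon *m mx22 a^* 0 0 a)
  else epsilon.

Definition mx_has_ac_derivative F G : Prop :=
  forall i j, has_ac_derivative (fun x => F x i j) (fun x => G x i j).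

(* F solves -epsilon F'' + Q F = z F on R_+, with F(0) = A and
   epsilon F'(0) = B. *)
Definition mx_solution p z F (A B : 'M[C]_2) : Prop :=
  exists F1 F2 : R -> 'M[C]_2,
    [/\ mx_has_ac_derivative F F1, mx_has_ac_derivative F1 F2,
        {ae lebesgue_measure, forall x : R, 0 < x ->
           - (epsilon *m F2 x) + mx22 0 (p x) (p x)^* 0 *m F x = z *: F x},
        F 0 = A & epsilon *m F1 0 = B].

(* M is the value M_alpha(z). *)
Definition is_M_value p alpha z (M : 'M[C]_2) : Prop :=
  exists Phi Theta : R -> 'M[C]_2,
    [/\ mx_solution p z Phi (bc_S alpha) (- bc_C alpha),
        mx_solution p z Theta (bc_C alpha) (bc_S alpha) &
        unique (fun N : 'M[C]_2 =>
          forall i j, L2 (fun x => (Theta x - Phi x *m N) i j)) M].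

(* The integral of g against dSigma = (1, psi; psi^*, 1) dnu. *)
Definition Sigma_integral (nu : {measure set (measurableTypeR R) -> \bar R})
    (psi g : R -> C) : 'M[C]_2 :=
  mx22 (cintegral nu setT g)
       (cintegral nu setT (fun t => g t * psi t))
       (cintegral nu setT (fun t => g t * (psi t)^*))
       (cintegral nu setT g).

(* psi is a representative of a class in L^oo(nu), so that it is only required
   to be odd, and bounded by 1, nu-almost everywhere. *)
Definition is_spectral_pair p alpha
    (nu : {measure set (measurableTypeR R) -> \bar R}) (psi : R -> C) : Prop :=
  [/\ forall A : set (measurableTypeR R), measurable A ->
        reflected nu A = nu A,
      cmeasurable setT psi,
      {ae nu, forall t : R, psi (- t) = - psi t},
      {ae nu, forall t : R, `|psi t| <= 1} &
      exists M : C -> 'M[C]_2,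
        [/\ forall z, complex.Im z != 0 -> is_M_value p alpha z (M z),
            herglotz_measure nu &
            forall z, complex.Im z != 0 ->
              M z = Remx (M 'i) + Sigma_integral nu psi (herglotz_kernel z)]].

End spectral_pair.

Section change_of_variable.
Variable R : realType.
Implicit Types (omega l : R) (B : set R).

Definition s_of omega l : R := Num.sqrt (l ^+ 2 + omega ^+ 2).

Definition s_preimage omega B : set R := [set l | 0 <= l /\ B (s_of omega l)].

(* In both right-hand sides below, the point l = 0, which is fixed by the
   reflection, enters once through sigma and once through sigma_*. If omega = 0
   and B contains 0, the integrands of [psi_rhs] are 0 at l = 0, as 0 / 0 = 0;
   this is the value there for an odd psi. *)
Definition nu_rhs (sigma : {measure set (measurableTypeR R) -> \bar R})
    omega B : \bar R :=
  ((2^-1)%:E * (sigma (s_preimage omega B)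
                + reflected sigma (s_preimage omega B)))%E.

Definition psi_rhs (sigma : {measure set (measurableTypeR R) -> \bar R})
    omega B : R[i] :=
  cintegral sigma (s_preimage omega B)
    (fun l => (l +i* omega) / (2 * s_of omega l)%:C)
  - cintegral (reflected sigma) (s_preimage omega B)
    (fun l => (l -i* omega) / (2 * s_of omega l)%:C).

End change_of_variable.

(* Main.v *)
Require Import Defs.
From HB Require Import structures.
From mathcomp Require Import all_boot all_order all_algebra.
From mathcomp Require Import all_classical all_reals all_analysis.
From mathcomp Require Import measurable_realfun complex.
From mathcomp Require Import ring lra.

Set Implicit Arguments.
Unset Strict Implicit.
Unset Printing Implicit Defensive.

Import Order.TTheory GRing.Theory Num.Theory.
Import numFieldNormedType.Exports.

Local Open Scope classical_set_scope.
Local Open Scope ring_scope.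
Local Open Scope complex_scope.

(* Multiplying the matrix equation by epsilon turns it into - F'' + q F = B F
   with B = (i omega, z; z, - i omega) and B^2 = l^2, where l^2 = z^2 - omega^2.
   Its solutions are therefore f(x, B) for the scalar solutions f(x, l), and
     M(z) = m(B) epsilon
          = (m(l) - m(-l)) / (2 l) B epsilon + (m(l) + m(-l)) / 2 epsilon.
   Insert the Herglotz representation of m. As t^2 - l^2 = s^2 - z^2 for
   s^2 = t^2 + omega^2, partial fractions in s exhibit the imaginary parts of
   M_11, (M_12 + M_21) / 2 and (M_12 - M_21) / (2 i) as Poisson integrals of
   images of sigma under t |-> s and t |-> - s, with densities 1 / 2 and
   +- t / (2 s), +- omega / (2 s). They are also the Poisson integrals of nu,
   (Re psi) nu and (Im psi) nu. A positive measure is determined by its Poisson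
   integral (Stieltjes inversion), which applies to nu, (1 + Re psi) nu and
   (1 + Im psi) nu. *)

(** * Stieltjes inversion *)

(** The uniqueness of M(z) is part of [is_M_value], so M(z) is found by exhibiting a matrix that
    makes the columns square integrable. No functional calculus in B is needed: its left
    eigenvectors for l and -l each reduce the system to one scalar equation. The three imaginary
    parts are chosen so that the additive constants drop out: Re m(i) is real and Re M(i) is
    Hermitian. The condition |psi| <= 1 makes 1 + Re psi and 1 + Im psi nonnegative, so that
    inversion for positive measures is enough; subtracting nu afterwards requires sets of finite
    measure. The delicate point is t = 0, the only one where t |-> s is not two-to-one. An atom of
    sigma there reaches |omega| and -|omega| with weight 1/2 each, whereas the right-hand side of
    the formula counts it once through sigma and once through its reflection. Both counts agree if
    omega = 0, as the two images then coincide, and differ by a factor 2 otherwise; hence the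
    separate treatment of the endpoint. *)

Definition poisson {R : realType} (x y t : R) : R :=
  y / ((t - x) ^+ 2 + y ^+ 2).

Section poisson_kernel.
Variable R : realType.
Notation TR := (measurableTypeR R).
Implicit Types a b c h t x y : R.

Lemma poisson_ge0 x y t : 0 < y -> 0 <= poisson x y t.
Proof. by move=> y0; rewrite divr_ge0 ?addr_ge0 ?sqr_ge0// ltW. Qed.

Lemma poisson_denom_gt0 x y t : 0 < y -> 0 < (t - x) ^+ 2 + y ^+ 2.
Proof. by move=> y0; rewrite ltr_wpDl ?sqr_ge0// exprn_gt0. Qed.

Lemma continuous_poisson_shift h y t : 0 < y ->
  continuous (fun x => poisson (x + h) y t).
Proof.
move=> y0 x; apply: cvgM; first exact: cvg_cst.
apply: cvgV; first by rewrite gt_eqF// poisson_denom_gt0.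
apply: cvgD; last exact: cvg_cst.
by apply: (@cvg_comp _ _ _ (fun x : R => t - (x + h)) (fun u : R => u ^+ 2));
  [apply: cvgB; [exact: cvg_cst|apply: cvgD; [exact: cvg_id|exact: cvg_cst]]
  |exact: exprn_continuous].
Qed.

Lemma integral_poisson a b h y t : a < b -> 0 < y ->
  (\int[lebesgue_measure]_(x in `[a, b]) (poisson (x + h) y t)%:E =
   (atan ((b + h - t) / y) - atan ((a + h - t) / y))%:E)%E.
Proof.
move=> ab y0; pose F x := atan ((x + h - t) / y).
have dF x : is_derive x 1 F (poisson (x + h) y t).
  have dg : is_derive x 1 (fun x => (x + h - t) / y) y^-1.
    by apply: is_derive_eq; rewrite /GRing.scale/=; ring.
  apply: is_derive_eq; rewrite /GRing.scale/= /poisson.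
  have := @poisson_denom_gt0 (x + h) y t y0.
  move=> /lt0r_neq0 d0; have y1 := lt0r_neq0 y0.
  have d1 : 1 + ((x + h - t) / y) ^+ 2 != 0.
    by rewrite gt_eqF// ltr_pwDl// sqr_ge0.
  field.
  by rewrite d0.
have cF x : {for x, continuous F}.
  by apply: differentiable_continuous; apply/derivable1_diffP; apply: ex_derive.
rewrite (@continuous_FTC2 _ _ F)//.
- by apply: continuous_subspaceT; exact: continuous_poisson_shift.
- split; first by move=> x _; exact: ex_derive.
  + by apply: cvg_at_right_filter; exact: cF.
  + by apply: cvg_at_left_filter; exact: cF.
- by move=> x _; rewrite derive1E; exact: derive_val.
Qed.
Let h_ n : R := n.+1%:R^-1.

Let h_gt0 n : 0 < h_ n. Proof. by rewrite invr_gt0. Qed.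

Let h_le1 n : h_ n <= 1. Proof. by rewrite invf_le1// ler1n. Qed.

Let cvg_atan_nat : (fun n : nat => atan (n.+1%:R : R)) @ \oo --> (pi / 2 : R).
Proof.
apply: (cvg_comp _ atan (G := +oo) _ (@cvgy_atan R)).
apply/cvgryPge => A; near=> n.
by rewrite (@le_trans _ _ n%:R) ?ler_nat//; near: n; exact: nbhs_infty_ger.
Unshelve. all: by end_near. Qed.

(* Approaching the real axis at x + h + i h^2, which is to the right of x by
   much more than the height, yields half-open intervals in the limit: no
   correction by half of the atoms at the endpoints is needed. *)
Lemma cvg_atan_step c t :
  (fun n => atan ((c + h_ n - t) / h_ n ^+ 2)) @ \oo -->
  (if t <= c then pi / 2 else - (pi / 2)).
Proof.
(* For t <= c the argument of the arctangent is at least h / h^2 = n + 1; for t > c it is at most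
   -(n + 1) as soon as h <= (t - c) / 2. *)
have e n : n.+1%:R = h_ n / h_ n ^+ 2.
  by rewrite expr2 invfM mulrA divff ?gt_eqF// mul1r invrK.
case: ifPn => [tc|]; last rewrite -ltNge => ct.
  apply: squeeze_cvgr; last 2 first.
  - exact: cvg_atan_nat.
  - exact: cvg_cst.
  apply: nearW => n; rewrite (ltW (atan_ltpi2 _)) andbT; apply: le_atan.
  by rewrite e ler_pM2r ?invr_gt0 ?exprn_gt0//; lra.
have dn : \forall n \near \oo, h_ n <= (t - c) / 2.
  have d0 : 0 < (t - c) / 2 by rewrite divr_gt0// subr_gt0.
  have := near_infty_natSinv_lt (PosNum d0).
  by apply: filterS => n /ltW.
have cN : (fun n : nat => - atan (n.+1%:R : R)) @ \oo --> (- (pi / 2) : R).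
  by apply: cvgN; exact: cvg_atan_nat.
apply: squeeze_cvgr (cvg_cst _) cN.
near=> n; rewrite (ltW (atan_gtNpi2 _))/= -atanN; apply: le_atan.
rewrite e -mulNr ler_pM2r ?invr_gt0 ?exprn_gt0//.
have : h_ n <= (t - c) / 2 by near: n.
by lra.
Unshelve. all: by end_near. Qed.

Lemma cvg_poisson_mean a b t : a < b ->
  (fun n => atan ((b + h_ n - t) / h_ n ^+ 2)
            - atan ((a + h_ n - t) / h_ n ^+ 2)) @ \oo -->
  pi * \1_(`]a, b] : set R) t.
Proof.
move=> ab.
rewrite (_ : pi * _ = (if t <= b then pi / 2 else - (pi / 2))
                      - (if t <= a then pi / 2 else - (pi / 2))).
  by apply: cvgB; exact: cvg_atan_step.
rewrite indicE mem_setE in_itv/=.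
have [ta|at_] := leP t a.
  by rewrite (le_trans ta (ltW ab)) mulr0 subrr.
by case: ifPn => _; rewrite ?mulr1 ?mulr0; lra.
Qed.

(** Supplies the dominating function for Stieltjes inversion, uniformly in h. For |t| < 2K the
    difference of arctangents is at most pi. For |t| >= 2K the point t stays at distance at least
    |t| / 2 from [a + h, b + h], and the difference is the integral of a Poisson kernel that decays
    like 1 / t^2. *)
Lemma poisson_mean_le a b : a < b -> exists2 C : R, 0 <= C & forall h t,
  0 < h -> h <= 1 ->
  atan ((b + h - t) / h ^+ 2) - atan ((a + h - t) / h ^+ 2) <= C / (1 + t ^+ 2).
Proof.
move=> ab; pose K : R := `|a| + `|b| + 1;
  pose C := 5 * (b - a) + pi * (1 + 4 * K ^+ 2).
have K1 : 1 <= K by rewrite lerDr addr_ge0.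
have pi0 := pi_ge0 R.
have C2 : pi * (1 + 4 * K ^+ 2) <= C by rewrite lerDr mulr_ge0// subr_ge0 ltW.
have C0 : 0 <= C.
  by rewrite (le_trans _ C2)// mulr_ge0// addr_ge0// mulr_ge0// sqr_ge0.
exists C => // h t h0 h1.
have h20 : 0 < h ^+ 2 by rewrite exprn_gt0.
have t0 : 0 < 1 + t ^+ 2 by rewrite ltr_pwDl// sqr_ge0.
rewrite ler_pdivlMr//; have [tK|tK] := ltP `|t| (2 * K).
  rewrite (le_trans _ C2)//; apply: ler_pM => //.
  - by rewrite subr_ge0 le_atan// ler_pM2r ?invr_gt0//; lra.
  - exact: ltW.
  - have := atan_ltpi2 ((b + h - t) / h ^+ 2).
    by have := atan_gtNpi2 ((a + h - t) / h ^+ 2); lra.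
  - rewrite lerD2l -(real_normK (num_real t)).
    have := normr_ge0 t; nra.
rewrite -ler_pdivlMr// -lee_fin -(integral_poisson _ _ ab h20).
(* Here |t| >= 2K >= 2, so 1 + t^2 <= 5 t^2 / 4 <= 5 (t - (x + h))^2; this is the origin of the
   constant 5. *)
have bd x : x \in `[a, b] -> poisson (x + h) (h ^+ 2) t <= 5 / (1 + t ^+ 2).
  rewrite in_itv/= => /andP[ax xb].
  have xhK : `|x + h| <= K.
    rewrite (le_trans (ler_normD _ _))// lerD//; last by rewrite gtr0_norm.
    rewrite ler_norml; apply/andP; split.
      by have := ler_norm (- a); have := normr_ge0 b; rewrite normrN; lra.
    by have := ler_norm b; have := normr_ge0 a; lra.
  have d : `|t| / 2 <= `|t - (x + h)|.
    by have := lerB_dist t (x + h); lra.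
  have d2 : t ^+ 2 / 4 <= (t - (x + h)) ^+ 2.
    rewrite -(real_normK (num_real t)) -(real_normK (num_real (t - _))).
    have := normr_ge0 t; nra.
  have t4 : 4 <= t ^+ 2.
    by rewrite -(real_normK (num_real t)); nra.
  rewrite /poisson ler_pdivrMr ?poisson_denom_gt0//.
  rewrite mulrAC ler_pdivlMr//.
  have h21 : h ^+ 2 <= 1 by rewrite exprn_ile1// ltW.
  have : h ^+ 2 * (1 + t ^+ 2) <= 1 + t ^+ 2 by rewrite ler_piMl// ltW.
  have := sqr_ge0 (h ^+ 2); lra.
have mitv : measurable (`[a, b]%classic : set TR) by [].
apply: (@le_trans _ _
  (\int[lebesgue_measure]_(x in `[a, b]) (5 / (1 + t ^+ 2))%:E)%E).
  apply: ge0_le_integral => //.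
  - by move=> x _; rewrite lee_fin poisson_ge0.
  - apply/measurable_EFinP/measurable_funTS.
    by apply: continuous_measurable_fun; exact: continuous_poisson_shift.
rewrite integral_cst//=.
rewrite lebesgue_measure_itv/= lte_fin ab -EFinD -EFinM lee_fin.
rewrite mulrAC ler_pM2r ?invr_gt0// /C lerDl.
by rewrite mulr_ge0// addr_ge0// mulr_ge0// sqr_ge0.
Qed.

End poisson_kernel.

Section stieltjes_inversion.
Local Open Scope ereal_scope.
Variable R : realType.
Notation TR := (measurableTypeR R).
Implicit Types mu : {measure set TR -> \bar R}.

Lemma measurable_inv1sqr D :
  measurable_fun (D : set TR) (fun t : R => ((1 + t ^+ 2)^-1)%:E).
Proof.
apply/measurable_EFinP/measurable_funTS.
apply: continuous_measurable_fun => x.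
apply: cvgV; first by rewrite gt_eqF// ltr_pwDl// sqr_ge0.
by apply: cvgD; [exact: cvg_cst|exact: exprn_continuous].
Qed.

Lemma measurable_poisson d (T : measurableType d) (f : T -> R) (x y : R) D :
  (0 < y)%R -> measurable_fun D f ->
    measurable_fun D (fun t => (poisson x y (f t))%:E).
Proof.
move=> y0 mf; apply/measurable_EFinP.
have mp : measurable_fun setT (poisson x y : TR -> TR).
  apply: continuous_measurable_fun => u.
  have := @continuous_poisson_shift R x y 0%R y0 (- u)%R.
  move=> /(@continuous_comp _ _ _ -%R (fun v => poisson (v + x) y 0) u).
  move=> /(_ (@oppr_continuous R R u)).
  rewrite (_ : _ \o _ = poisson x y)//; apply/funext => v /=.
  by rewrite /poisson; congr (_ / (_ ^+ 2 + _))%R; ring.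
exact: measurableT_comp.
Qed.

(** A Chebyshev estimate: (1 + n^2) / (1 + t^2) is at least 1 on the interval. *)
Lemma herglotz_measure_itv_lty mu (n : R) : herglotz_measure mu ->
  mu `](- n)%R, n]%classic < +oo.
Proof.
move=> hmu; have n0 : (0 <= 1 + n ^+ 2)%R by rewrite addr_ge0 ?sqr_ge0.
rewrite (@le_lt_trans _ _
  ((1 + n ^+ 2)%:E * \int[mu]_t ((1 + t ^+ 2)^-1)%:E))//; last first.
  by rewrite lte_mul_pinfty ?lee_fin.
have g0 t : (0 <= (1 + t ^+ 2)^-1 :> R)%R by rewrite invr_ge0 addr_ge0 ?sqr_ge0.
rewrite -ge0_integralZl_EFin//; last 2 first.
- by move=> t _; rewrite lee_fin.
- exact: measurable_inv1sqr.
apply: (@le_trans _ _ (\int[mu]_(t in `](- n)%R, n]%classic)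
  ((1 + n ^+ 2)%:E * ((1 + t ^+ 2)^-1)%:E))).
  rewrite -[leLHS]mul1e -integral_cst//; apply: ge0_le_integral => //.
  - by apply: measurable_funeM; exact: measurable_inv1sqr.
  - move=> t /=; rewrite in_itv/= => /andP[nt tn].
    rewrite -EFinM lee_fin ler_pdivlMr ?mul1r;
      last by rewrite ltr_pwDl ?sqr_ge0.
    by rewrite lerD2l; nra.
apply: ge0_subset_integral => //.
- by apply: measurable_funeM; exact: measurable_inv1sqr.
- by move=> t _; rewrite lee_fin mulr_ge0.
Qed.

Lemma bigcup_itvNn : \bigcup_n `](- n%:R : R)%R, n%:R%R]%classic = setT.
Proof.
apply/seteqP; split => // t _; exists (Num.truncn `|t|).+1 => //=.
have := truncnS_gt `|t|; rewrite in_itv/= ltrNl => tn.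
rewrite (le_lt_trans _ tn)/=; last by rewrite -normrN ler_norm.
by rewrite (le_trans (ler_norm t))// ltW.
Qed.

Lemma herglotz_measure_sigma_finite mu : herglotz_measure mu ->
  sigma_finite setT mu.
Proof.
move=> hmu; exists (fun n => `](- n%:R : R)%R, n%:R%R]%classic) => [|n].
  by rewrite bigcup_itvNn.
by split => //; exact: herglotz_measure_itv_lty.
Qed.

Lemma measurable_poisson_shift (h y : R) : (0 < y)%R ->
  measurable_fun setT (fun p : TR * TR => (poisson (p.1 + h) y p.2)%:E).
Proof.
move=> y0;
  rewrite (_ : (fun _ => _) =
  (fun p : TR * TR => (poisson h y (p.2 - p.1))%:E)).
  by apply: measurable_poisson => //; exact: measurable_funB.
by apply/funext => p; rewrite /poisson opprD addrA.
Qed.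

Lemma integral_poisson_mean mu (a b h y : R) : herglotz_measure mu ->
  (a < b)%R -> (0 < y)%R ->
  \int[lebesgue_measure]_(x in `[a, b]) \int[mu]_t (poisson (x + h) y t)%:E =
  \int[mu]_t (atan ((b + h - t) / y) - atan ((a + h - t) / y))%:E.
Proof.
move=> hmu ab y0.
have smu_ := herglotz_measure_sigma_finite hmu.
(* Tonelli's theorem asks for a sigma-finite structure, which [mu] has only through
   [herglotz_measure]; it is repackaged under the name [smu]. *)
pose H1 := isSigmaFinite.Build _ TR R mu smu_.
pose H2 := isSFinite.Build _ TR R mu (sfinite_measure_sigma_finite smu_).
pose smu := HB.pack_for (SigmaFiniteMeasure.type TR R) (Measure.sort mu) H1 H2.
pose f (p : TR * TR) :=
  ((poisson (p.1 + h) y p.2) * \1_(`[a, b]%classic : set R) p.1)%:E.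
have p0 x t : (0 <= poisson (x + h) y t)%R by exact: poisson_ge0.
have mp := @measurable_poisson_shift h y y0.
have mf : measurable_fun setT f.
  apply/measurable_EFinP/measurable_funM; first exact/measurable_EFinP.
  apply: (@measurableT_comp _ _ _ _ _ _ (\1_(`[a, b]%classic : set TR) : TR -> R)
    _ fst) => //.
have f0 p : 0 <= f p by rewrite lee_fin mulr_ge0.
have := @fubini_tonelli _ _ TR TR R lebesgue_measure smu f mf f0.
under eq_integral.
  move=> x _;
    rewrite (_ : \int[_]_y _ =
    ((fun x => \int[mu]_t (poisson (x + h) y t)%:E) \_ `[a, b]) x); last first.
    rewrite /f/= patchE indicE; case: ifPn => _.
      by under eq_integral do rewrite mulr1.
    by under eq_integral do rewrite mulr0; rewrite integral0.
  over.
rewrite -integral_mkcond => ->; apply: eq_integral => t _.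
rewrite -(integral_poisson h t ab y0) [RHS]integral_mkcond;
  apply: eq_integral => x _.
by rewrite /f/= patchE indicE; case: ifPn => _; rewrite ?mulr1 ?mulr0.
Qed.

(** Tonelli's theorem moves the integral over [a, b] inside, where it is a difference of
    arctangents. This tends pointwise to pi times the indicator of ]a, b], and [poisson_mean_le]
    allows dominated convergence because [mu] integrates 1 / (1 + t^2). *)
Lemma poisson_inversion mu (a b : R) : herglotz_measure mu -> (a < b)%R ->
  (fun n => \int[lebesgue_measure]_(x in `[a, b])
     \int[mu]_t (poisson (x + n.+1%:R^-1) (n.+1%:R^-1 ^+ 2) t)%:E) @ \oo -->
  pi%:E * mu `]a, b]%classic.
Proof.
move=> hmu ab.
under eq_fun do rewrite integral_poisson_mean//.
have [C C0 hC] := poisson_mean_le ab.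
have Cint : mu.-integrable setT (fun t => (C / (1 + t ^+ 2))%:E).
  apply/integrableP; split.
    apply/measurable_EFinP/measurable_funM => //; apply/measurable_EFinP.
    exact: measurable_inv1sqr.
  rewrite (eq_integral (fun t : TR => C%:E * ((1 + t ^+ 2)^-1)%:E)); last first.
    by move=> t _; rewrite gee0_abs ?EFinM// lee_fin divr_ge0// addr_ge0//
      sqr_ge0.
  rewrite ge0_integralZl_EFin//.
  - by rewrite lte_mul_pinfty ?lee_fin.
  - by move=> t _; rewrite lee_fin invr_ge0 addr_ge0// sqr_ge0.
  - exact: measurable_inv1sqr.
have matan (c h y : R) : measurable_fun setT
  (fun t : TR => atan ((c + h - t) / y)).
  apply: (@measurableT_comp _ _ _ _ _ _ (@atan R : TR -> TR)).
    by apply: continuous_measurable_fun => x; exact: continuous_atan.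
  by apply: measurable_funM => //; exact: measurable_funB.
have h0 n : (0 < n.+1%:R^-1 :> R)%R by rewrite invr_gt0.
have [||||| _ _] := @dominated_convergence _ TR R mu setT measurableT
  (fun n t => (atan ((b + n.+1%:R^-1 - t) / n.+1%:R^-1 ^+ 2)
    - atan ((a + n.+1%:R^-1 - t) / n.+1%:R^-1 ^+ 2))%:E)
  (fun t => (pi * \1_(`]a, b]%classic : set R) t)%:E)
  (fun t => (C / (1 + t ^+ 2))%:E).
- by move=> n; apply/measurable_EFinP/measurable_funB; exact: matan.
- by apply/measurable_EFinP/measurable_funM.
- apply: aeW => t _; apply: cvg_EFin; first exact: nearW.
  exact: cvg_poisson_mean.
- exact: Cint.
- apply: aeW => t n _; rewrite gee0_abs ?lee_fin;
  first by rewrite hC ?invf_le1 ?ler1n.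
  by rewrite subr_ge0 le_atan// ler_pM2r ?invr_gt0 ?exprn_gt0 ?invr_gt0//
    !lerD2r ltW.
rewrite (_ : \int[mu]_t (pi * \1_`]a, b] t)%:E = pi%:E * mu `]a, b]%classic);
  first exact.
under eq_integral do rewrite EFinM.
rewrite ge0_integralZl_EFin ?pi_ge0//; first by rewrite integral_indic// setIT.
by apply/measurable_EFinP.
Qed.

(** The inversion formula settles the half-open intervals, which are closed under intersection,
    generate the Borel sets and exhaust the line by sets of finite measure. *)
Lemma poisson_unique mu1 mu2 : herglotz_measure mu1 -> herglotz_measure mu2 ->
  (forall x y : R, (0 < y)%R ->
    \int[mu1]_t (poisson x y t)%:E = \int[mu2]_t (poisson x y t)%:E) ->
  forall A, measurable A -> mu1 A = mu2 A.
Proof.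
move=> h1 h2 e A mA.
apply: (@measure_unique _ R TR (@ocitv R)
  (fun n => `](- n%:R : R)%R, n%:R%R]%classic : set TR)) => //.
- exact: ocitvI.
- by move=> n; exact: is_ocitv.
- by rewrite bigcup_itvNn.
- move=> _ [[a b] _ <-] /=; have [ab|ba] := ltP a b; last first.
    by rewrite set_itv_ge ?measure0// bnd_simp -leNgt.
  have := poisson_inversion h1 ab; have := poisson_inversion h2 ab.
  have e' n x : \int[mu1]_t (poisson (x + n.+1%:R^-1) (n.+1%:R^-1 ^+ 2) t)%:E =
     \int[mu2]_t (poisson (x + n.+1%:R^-1) (n.+1%:R^-1 ^+ 2) t)%:E.
    by rewrite e ?exprn_gt0// invr_gt0.
  under [X in _ -> X @ _ --> _ -> _]eq_fun do under eq_integral do rewrite e'.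
  move=> l2 l1.
  have : pi%:E * mu1 `]a, b]%classic = pi%:E * mu2 `]a, b]%classic.
    exact: cvg_unique l1 l2.
  move=> /(congr1 (fun u => (pi^-1)%:E * u)).
  by rewrite !muleA -EFinM mulVf ?gt_eqF ?pi_gt0// !mul1e.
- by move=> n; exact: herglotz_measure_itv_lty.
Qed.

End stieltjes_inversion.

(** * Measures with a density *)

Section density_pushforward.
Local Open Scope ereal_scope.
Context d1 d2 (X : measurableType d1) (Y : measurableType d2) (R : realType).
Variables (mu : {measure set X -> \bar R}) (phi : X -> Y) (w : X -> R).
Hypotheses (mphi : measurable_fun setT phi) (mw : measurable_fun setT w).
Hypothesis w0 : forall x, (0 <= w x)%R.

Import HBNNSimple.

(** This is the image under [phi] of the measure [w] dmu. The transfer formula is checked on simple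
    functions and extended by monotone convergence. *)
Lemma density_pushforward : exists rho : {measure set Y -> \bar R},
  (forall A, rho A = \int[mu]_(x in phi @^-1` A) (w x)%:E) /\
  (forall f : Y -> \bar R, measurable_fun setT f -> (forall y, 0 <= f y) ->
    \int[rho]_y f y = \int[mu]_x (f (phi x) * (w x)%:E)).
Proof.
have mEw : measurable_fun setT (fun x => (w x)%:E) by exact/measurable_EFinP.
have Ew0 x : 0 <= (w x)%:E by rewrite lee_fin.
have mpre A : measurable A -> measurable (phi @^-1` A).
  by move=> mA; rewrite -[X in measurable X]setTI; exact: mphi.
pose r (A : set Y) := \int[mu]_(x in phi @^-1` A) (w x)%:E.
have r0 : r set0 = 0 by rewrite /r preimage_set0 integral_set0.
have r_ge0 A : 0 <= r A by exact: integral_ge0.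
have rs : semi_sigma_additive r.
  move=> F mF tF mUF; rewrite /r preimage_bigcup.
  apply: (semi_sigma_additive_nng_induced mEw Ew0).
  - by move=> n; exact: mpre.
  - apply/trivIsetP => /= i j _ _ ij; rewrite -preimage_setI.
    by move/trivIsetP : tF => /(_ _ _ _ _ ij) -> //; rewrite preimage_set0.
  - by rewrite -preimage_bigcup; exact: mpre.
pose rho := HB.pack_for (Measure.type Y R) r
  (isMeasure.Build _ Y R r r0 r_ge0 rs).
exists rho; split => // f mf f0.
pose h := nnsfun_approx measurableT mf.
have -> : \int[rho]_x f x = lim (\int[rho]_x (EFin \o h n) x @[n --> \oo]).
  have fE x : f x = lim ((EFin \o h n) x @[n --> \oo]).
    by apply/esym/cvg_lim => //; exact: cvg_nnsfun_approx.
  under eq_integral => x _ do rewrite fE.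
  apply: monotone_convergence => //.
  - by move=> n; apply/measurable_EFinP.
  - by move=> n x _ //=; rewrite lee_fin.
  - by move=> x _ a b ab; rewrite lee_fin; exact/lefP/nd_nnsfun_approx.
have mh n : measurable_fun setT (fun x => (h n (phi x))%:E).
  by apply/measurable_EFinP; exact: measurableT_comp.
have -> : \int[mu]_x (f (phi x) * (w x)%:E) =
    lim (\int[mu]_x ((h n (phi x))%:E * (w x)%:E) @[n --> \oo]).
  have fg x : f (phi x) * (w x)%:E =
    lim (((h n (phi x))%:E * (w x)%:E) @[n --> \oo]).
    apply/esym/cvg_lim => //; apply: cvgeZr => //.
    exact: cvg_nnsfun_approx.
  under eq_integral => x _ do rewrite fg.
  apply: monotone_convergence => //.
  - by move=> n; exact: emeasurable_funM.
  - by move=> n x _ /=; rewrite mule_ge0 ?lee_fin.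
  - move=> x _ a b ab; rewrite lee_wpmul2r ?lee_fin//.
    exact/lefP/nd_nnsfun_approx.
apply: congr_lim; apply/funext => n.
transitivity (\int[rho]_x
   (\sum_(y \in range (h n)) (y * \1_(h n @^-1` [set y]) x)%:E)).
  by apply: eq_integral => t _; rewrite /= fimfunE -fsumEFin.
have mind y : measurable_fun setT (fun x => (y * \1_(h n @^-1` [set y]) x)%:E).
  by apply/measurable_EFinP; exact: measurable_funM.
rewrite ge0_integral_fsum//; last by move=> m y _; exact: nnfun_muleindic_ge0.
transitivity (\int[mu]_x (\sum_(y \in range (h n))
    (y * \1_(h n @^-1` [set y]) (phi x))%:E * (w x)%:E)); last first.
  apply: eq_integral => x _.
  rewrite -ge0_mule_fsuml => [|y]; last exact: nnfun_muleindic_ge0.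
  by rewrite fsumEFin // -(fimfunE _ (phi x)).
have mindphi y : measurable_fun setT
  (fun x => (y * \1_(h n @^-1` [set y]) (phi x))%:E).
  exact: (measurableT_comp (mind y)).
rewrite ge0_integral_fsum//; last 2 first.
- by move=> y; exact: emeasurable_funM.
- by move=> y x _; rewrite mule_ge0// nnfun_muleindic_ge0.
apply: eq_fsbigr => y; rewrite inE => -[t _ ht].
have y0 : (0 <= y)%R by rewrite -ht.
under eq_integral do rewrite EFinM.
rewrite integralZl_indic_nnsfun// integral_indic//= setIT.
under [RHS]eq_integral do rewrite EFinM -muleA.
have mind1 : measurable_fun setT
  (fun x => (\1_(h n @^-1` [set y]) (phi x))%:E : \bar R).
  by apply/measurable_EFinP; exact: measurableT_comp.
rewrite ge0_integralZl//.
- congr (_ * _); rewrite [LHS]integral_mkcond; apply: eq_integral => x _.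
  by rewrite muleC epatch_indic.
- exact: emeasurable_funM.
- by move=> x _; rewrite mule_ge0 ?lee_fin.
Qed.

End density_pushforward.

Section poisson_transfer.
Local Open Scope ereal_scope.
Variable R : realType.
Notation TR := (measurableTypeR R).
Variables (mu sigma : {measure set TR -> \bar R}) (phi1 phi2 w w1 w2 : TR -> R).
Hypotheses (mphi1 : measurable_fun setT (phi1 : TR -> TR))
  (mphi2 : measurable_fun setT (phi2 : TR -> TR)).
Hypotheses (mw : measurable_fun setT w) (mw1 : measurable_fun setT w1)
  (mw2 : measurable_fun setT w2).
Hypotheses (w_ge0 : forall x, (0 <= w x)%R) (w1_ge0 : forall x, (0 <= w1 x)%R)
  (w2_ge0 : forall x, (0 <= w2 x)%R).

(** [poisson_unique] compares [w] dmu with the sum of the images of [w1] dsigma under [phi1] and of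
    [w2] dsigma under [phi2]. *)
Lemma poisson_transfer :
  \int[mu]_t ((1 + t ^+ 2)^-1 * w t)%:E < +oo ->
  (forall x y : R, (0 < y)%R -> \int[mu]_t (poisson x y t * w t)%:E =
    \int[sigma]_t (poisson x y (phi1 t) * w1 t + poisson x y (phi2 t) *
      w2 t)%:E) ->
  forall A : set TR, measurable A -> \int[mu]_(t in A) (w t)%:E =
    \int[sigma]_(t in phi1 @^-1` A) (w1 t)%:E + \int[sigma]_(t in phi2 @^-1` A)
      (w2 t)%:E.
Proof.
move=> wfin e A mA.
have [rho [rhoE rhof]] := @density_pushforward _ _ TR TR R mu id w
  (@measurable_id _ TR setT) mw w_ge0.
have [rho1 [rho1E rho1f]] := density_pushforward sigma mphi1 mw1 w1_ge0.
have [rho2 [rho2E rho2f]] := density_pushforward sigma mphi2 mw2 w2_ge0.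
pose rho' : {measure set TR -> \bar R} := measure_add rho1 rho2.
have mP (x y : R) : (0 < y)%R -> measurable_fun setT
  (fun t : TR => (poisson x y t)%:E).
  by move=> y0; exact: measurable_poisson.
have P0 (x y t : R) : (0 < y)%R -> 0 <= (poisson x y t)%:E.
  by move=> y0; rewrite lee_fin poisson_ge0.
have e' (x y : R) : (0 < y)%R ->
    \int[rho]_t (poisson x y t)%:E = \int[rho']_t (poisson x y t)%:E.
  move=> y0; rewrite ge0_integral_measure_add//;
    [|by move=> t _; exact: P0|exact: mP].
  rewrite rhof ?rho1f ?rho2f//; do ?[exact: mP|by move=> t; exact: P0].
  rewrite -ge0_integralD//.
  - under eq_integral do rewrite -EFinM.
    by rewrite e//; apply: eq_integral => t _; rewrite -!EFinM -EFinD.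
  - by move=> t _; rewrite mule_ge0 ?P0// lee_fin.
  - apply: emeasurable_funM; last exact/measurable_EFinP.
    exact: measurable_poisson.
  - by move=> t _; rewrite mule_ge0 ?P0// lee_fin.
  - apply: emeasurable_funM; last exact/measurable_EFinP.
    exact: measurable_poisson.
(* The Herglotz weight is itself a Poisson kernel, so the assumed identity at x = 0, y = 1 also
   shows that the measure built from [sigma] is a Herglotz measure. *)
have hE (t : R) : ((1 + t ^+ 2)^-1)%R = poisson 0 1 t.
  by rewrite /poisson subr0 expr1n div1r addrC.
have hrho : herglotz_measure rho.
  rewrite /herglotz_measure rhof.
  - by under eq_integral do rewrite -EFinM.
  - exact: measurable_inv1sqr.
  - by move=> t; rewrite hE P0.
have hrho' : herglotz_measure rho'.
  rewrite /herglotz_measure; under eq_integral do rewrite hE.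
  rewrite -e'//; under eq_integral do rewrite -hE.
  exact: hrho.
have := poisson_unique hrho hrho' e' mA.
by rewrite rhoE preimage_id [rho' A]measure_addE rho1E rho2E.
Qed.

End poisson_transfer.

(** * Complex integrals and the scalar equation *)

Lemma ae_imply2 d (T : measurableType d) (R : realType)
    (mu : {measure set T -> \bar R}) (P Q S : T -> Prop) :
  (forall x, P x -> Q x -> S x) -> {ae mu, forall x, P x} ->
  {ae mu, forall x, Q x} -> {ae mu, forall x, S x}.
Proof. by move=> PQS; exact: filterS2. Qed.

Lemma ae_imply d (T : measurableType d) (R : realType)
    (mu : {measure set T -> \bar R}) (P S : T -> Prop) :
  (forall x, P x -> S x) -> {ae mu, forall x, P x} -> {ae mu, forall x, S x}.
Proof. by move=> PS; exact: filterS. Qed.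

Section complex_integral.
Variable R : realType.
Notation TR := (measurableTypeR R).
Notation Re := complex.Re.
Notation Im := complex.Im.
Implicit Types (mu : {measure set TR -> \bar R}) (D : set TR) (f g : R -> R[i]).

Lemma Re_mulc (u v : R[i]) : Re (u * v) = Re u * Re v - Im u * Im v.
Proof. by case: u; case: v. Qed.

Lemma Im_mulc (u v : R[i]) : Im (u * v) = Re u * Im v + Im u * Re v.
Proof. by case: u; case: v. Qed.

Lemma Re_addc (u v : R[i]) : Re (u + v) = Re u + Re v.
Proof. by case: u; case: v. Qed.

Lemma Im_addc (u v : R[i]) : Im (u + v) = Im u + Im v.
Proof. by case: u; case: v. Qed.

Lemma cintegrableD mu D f g : measurable D -> cintegrable mu D f ->
  cintegrable mu D g -> cintegrable mu D (fun x => f x + g x).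
Proof.
move=> mD [rf jf] [rg jg]; split.
- under eq_fun do rewrite Re_addc EFinD; exact: integrableD.
- under eq_fun do rewrite Im_addc EFinD; exact: integrableD.
Qed.

Lemma cintegrableZ mu D (c : R[i]) f : measurable D -> cintegrable mu D f ->
  cintegrable mu D (fun x => c * f x).
Proof.
move=> mD [rf jf]; split.
- under eq_fun do rewrite Re_mulc EFinB !EFinM.
  by apply: integrableB => //; exact: integrableZl.
- under eq_fun do rewrite Im_mulc EFinD !EFinM.
  by apply: integrableD => //; exact: integrableZl.
Qed.

Lemma cintegralD mu D f g : measurable D -> cintegrable mu D f ->
  cintegrable mu D g ->
  cintegral mu D (fun x => f x + g x) = cintegral mu D f + cintegral mu D g.
Proof.
move=> mD [rf jf] [rg jg]; rewrite /cintegral; apply/eqP; rewrite eq_complex/=.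
rewrite -!RintegralD//; apply/andP; split; apply/eqP;
  apply: eq_Rintegral => x _.
- by rewrite Re_addc.
- by rewrite Im_addc.
Qed.

Lemma cintegralZ mu D (c : R[i]) f : measurable D -> cintegrable mu D f ->
  cintegral mu D (fun x => c * f x) = c * cintegral mu D f.
Proof.
move=> mD [rf jf].
have iZ (r : R) (h : R -> R) : mu.-integrable D (fun x => (h x)%:E) ->
    mu.-integrable D (EFin \o (fun x => r * h x)).
  by move=> ih; apply: eq_integrable (integrableZl mD r ih).
rewrite /cintegral; apply/eqP; rewrite eq_complex Re_mulc Im_mulc/=.
rewrite -!RintegralZl// -RintegralB -?RintegralD//; try exact: iZ.
apply/andP; split; apply/eqP; apply: eq_Rintegral => x _.
- by rewrite Re_mulc.
- by rewrite Im_mulc.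
Qed.

(** The l^1 norm is used instead of the modulus because it is real-valued and splits along real and
    imaginary parts, as [cintegral] does; it is still submultiplicative. *)
Definition norm1c (z : R[i]) : R := `|Re z| + `|Im z|.

Lemma norm1c_ge0 z : 0 <= norm1c z.
Proof. by rewrite addr_ge0. Qed.

Lemma norm1c_eq0 z : norm1c z <= 0 -> z = 0.
Proof.
case: z => a b; rewrite /norm1c/= => ab0.
have a0 : `|a| <= 0 by rewrite (le_trans _ ab0)// lerDl.
have b0 : `|b| <= 0 by rewrite (le_trans _ ab0)// lerDr.
by move: a0 b0; rewrite !normr_le0 => /eqP -> /eqP ->.
Qed.

Lemma norm1cM u v : norm1c (u * v) <= norm1c u * norm1c v.
Proof.
rewrite /norm1c Re_mulc Im_mulc.
apply: (le_trans (lerD (ler_normB _ _) (ler_normD _ _))).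
by rewrite !normrM; lra.
Qed.

Lemma norm1cD u v : norm1c (u + v) <= norm1c u + norm1c v.
Proof.
rewrite /norm1c Re_addc Im_addc.
by apply: (le_trans (lerD (ler_normD _ _) (ler_normD _ _))); lra.
Qed.

Lemma norm1c_cintegral_le mu D g (G : R -> R) : measurable D ->
  cintegrable mu D g -> measurable_fun D G -> (forall t, D t -> 0 <= G t) ->
  {ae mu, forall t, D t -> norm1c (g t) <= G t} ->
  ((norm1c (cintegral mu D g))%:E <= \int[mu]_(t in D) (G t)%:E)%E.
Proof.
move=> mD [rg jg] mG G0 gG.
have mrg := measurable_int mu rg; have mjg := measurable_int mu jg.
apply: (@le_trans _ _
  (\int[mu]_(t in D) (`|(Re (g t))%:E| + `|(Im (g t))%:E|))%E).
  rewrite /norm1c/= EFinD ge0_integralD//; last 2 first.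
  - by apply/measurable_EFinP/measurableT_comp => //; exact/measurable_EFinP.
  - by apply/measurable_EFinP/measurableT_comp => //; exact/measurable_EFinP.
  by rewrite !EFin_normr_Rintegral// leeD//; exact: le_abse_integral.
apply: ae_ge0_le_integral => //.
- by move=> t _; rewrite adde_ge0.
- by apply: emeasurable_funD; exact: measurableT_comp.
- exact/measurable_EFinP.
Qed.

End complex_integral.

(** * Linearity and uniqueness for the scalar initial value problem, solutions being understood
    almost everywhere *)

Section linear_ode.
Variable R : realType.
Notation TR := (measurableTypeR R).
Notation Re := complex.Re.
Notation Im := complex.Im.
Notation leb := (@lebesgue_measure R).
Implicit Types (q : R -> R) (l : R[i]) (f g : R -> R[i]).

Lemma has_ac_derivative_lin (c d : R[i]) f f1 g g1 :
  has_ac_derivative f f1 -> has_ac_derivative g g1 ->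
  has_ac_derivative (fun x => c * f x + d * g x) (fun x => c * f1 x + d * g1 x).
Proof.
move=> hf hg x x0; have [if1 fE] := hf x x0; have [ig1 gE] := hg x x0.
have mD : measurable (`[0, x]%classic : set TR) by [].
have icf := cintegrableZ c mD if1; have idg := cintegrableZ d mD ig1.
split; first exact: cintegrableD.
by rewrite cintegralD// !cintegralZ// fE gE; ring.
Qed.

Lemma scalar_solution_lin q l (c d : R[i]) f g (a b a' b' : R[i]) :
  scalar_solution q l f a b -> scalar_solution q l g a' b' ->
  scalar_solution q l (fun x => c * f x + d * g x)
    (c * a + d * a') (c * b + d * b').
Proof.
move=> [f1 [f2 [hf hf1 ef <- <-]]] [g1 [g2 [hg hg1 eg <- <-]]].
exists (fun x => c * f1 x + d * g1 x), (fun x => c * f2 x + d * g2 x).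
split => //; [exact: has_ac_derivative_lin..|].
apply: ae_imply2 ef eg => x ef eg x0.
transitivity (c * (- f2 x + (q x)%:C * f x) + d * (- g2 x + (q x)%:C * g x)).
  by ring.
by rewrite ef// eg//; ring.
Qed.

Lemma integral_expR_le (c x : R) : 0 < c -> 0 < x ->
  (\int[leb]_(t in `[0%R, x]) (expR (c * t))%:E <= (expR (c * x) / c)%:E)%E.
Proof.
move=> c0 x0; pose F t := expR (c * t) / c.
have dF (t : R) : is_derive t 1 F (expR (c * t)).
  by apply: is_derive_eq; rewrite /GRing.scale/=; field; rewrite gt_eqF.
have cF (t : R) : {for t, continuous F}.
  by apply: differentiable_continuous; apply/derivable1_diffP; apply: ex_derive.
rewrite (@continuous_FTC2 _ _ F)//.
- by rewrite -EFinB lee_fin gerBl divr_ge0 ?expR_ge0// ltW.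
- apply: continuous_subspaceT => t; apply: continuous_comp;
  last exact: continuous_expR.
  exact: mulrl_continuous.
- split; first by move=> t _; exact: ex_derive.
  + by apply: cvg_at_right_filter; exact: cF.
  + by apply: cvg_at_left_filter; exact: cF.
- by move=> t _; rewrite derive1E; exact: derive_val.
Qed.

(* Iterating Gronwall-style with the weight e^(c t): a bound M e^(c t) on f
   improves to the bound (M / 2) e^(c t) as soon as c^2 >= 2 L. *)
Lemma second_order_ode_unique0 (L : R) f f1 f2 : 0 <= L ->
  has_ac_derivative f f1 -> has_ac_derivative f1 f2 ->
  {ae leb, forall x : R, 0 < x -> norm1c (f2 x) <= L * norm1c (f x)} ->
  f 0 = 0 -> f1 0 = 0 -> forall x : R, 0 <= x -> f x = 0.
Proof.
move=> L0 hf hf1 f2f f00 f10 X; rewrite le_eqVlt => /predU1P[<-//|X0].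
(* This gives c^2 >= 4L, and c > 0 even if L = 0. *)
pose c := L + 2; have c0 : 0 < c by rewrite /c; lra.
have mitv (x : R) : measurable (`[0, x]%classic : set TR) by [].
have mexp (M x : R) : measurable_fun (`[0, x]%classic : set TR)
    (fun t : R => M * expR (c * t)).
  apply: measurable_funTS; apply: continuous_measurable_fun => t.
  apply: cvgM; first exact: cvg_cst.
  apply: continuous_comp; last exact: continuous_expR.
  exact: mulrl_continuous.
(* One integration from a zero initial value gains a factor 1 / c against the weight; it is applied
   to [f1] and then to [f]. *)
have step (M : R) (u u1 : R -> R[i]) : 0 <= M -> has_ac_derivative u u1 ->
    u 0 = 0 ->
    {ae leb, forall t : R, 0 < t -> t <= X ->
      norm1c (u1 t) <= M * expR (c * t)} ->
    forall x : R, 0 <= x -> x <= X -> norm1c (u x) <= M / c * expR (c * x).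
  move=> M0 hu u0 bu x; rewrite le_eqVlt => /predU1P[<-|x0] xX.
    rewrite u0 /norm1c/= normr0 addr0 mulr_ge0 ?expR_ge0// divr_ge0//.
    exact: ltW.
  have [iu1 ->] := hu x (ltW x0); rewrite u0 add0r -lee_fin.
  apply: (le_trans (norm1c_cintegral_le (mitv x) iu1 (mexp M x) _ _)).
  - by move=> t _; rewrite mulr_ge0 ?expR_ge0.
  (* The bound is assumed for t > 0 only, while the integral runs over the closed interval. *)
  - have n0 : {ae leb, forall t : R, t != 0}.
      exists [set 0]; split => //; first exact: lebesgue_measure_set1.
      by move=> t /= /negP; rewrite negbK => /eqP.
    apply: ae_imply2 bu n0 => t bu t0; rewrite /= in_itv/= => /andP[t0' tx].
    by apply: bu; [rewrite lt_neqAle eq_sym t0|exact: le_trans xX].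
  - under eq_integral do rewrite EFinM.
    rewrite ge0_integralZl_EFin//; first last.
    + apply/measurable_EFinP; apply: eq_measurable_fun (mexp 1 x) => t _.
      by rewrite mul1r.
    + rewrite (_ : M / c * _ = M * (expR (c * x) / c)); last by ring.
      by rewrite [leRHS]EFinM lee_wpmul2l ?lee_fin// integral_expR_le.
have contract (M : R) : 0 <= M ->
  (forall x : R, 0 <= x -> x <= X -> norm1c (f x) <= M * expR (c * x)) ->
    forall x : R, 0 <= x -> x <= X -> norm1c (f x) <= M / 2 * expR (c * x).
  move=> M0 bf x x0 xX.
  have b1 : forall t : R, 0 <= t -> t <= X ->
    norm1c (f1 t) <= L * M / c * expR (c * t).
    apply: (step _ _ _ _ hf1 f10); first exact: mulr_ge0.
    apply: ae_imply f2f => t h t0 tX; rewrite (le_trans (h t0))//.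
    by rewrite -mulrA ler_wpM2l// bf// ltW.
  have LM : 0 <= L * M / c by rewrite divr_ge0 ?mulr_ge0// ltW.
  rewrite (le_trans (@step _ _ _ LM hf f00 _ x x0 xX))//.
    by apply: aeW => t t0 tX; exact: b1 (ltW t0) tX.
  rewrite ler_wpM2r ?expR_ge0// (_ : L * M / c / c = M * (L / (c * c)));
    last first.
    by field; rewrite gt_eqF.
  rewrite ler_wpM2l// ler_pdivrMr ?mulr_gt0// /c; nra.
have [if1X _] := hf X (ltW X0).
(* The iteration starts from the bound of [f] by the integral of |f1| over [0, X], the weight being
   at least 1. *)
have [M0 M00 bf0] : exists2 M0 : R, 0 <= M0 &
    forall x : R, 0 <= x -> x <= X -> norm1c (f x) <= M0 * expR (c * x).
  have mN : measurable_fun (`[0, X]%classic : set TR) (fun t => norm1c (f1 t)).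
    have [/measurable_int/measurable_EFinP mr /measurable_int/measurable_EFinP
      mi] := if1X.
    by apply: measurable_funD; exact: measurableT_comp.
  have fin : (\int[leb]_(t in `[0%R, X]) (norm1c (f1 t))%:E)%E \is a fin_num.
    apply: integrable_fin_num => //; have [ir ii] := if1X.
    by apply: eq_integrable
      (integrableD (mitv X) (integrable_abse ir) (integrable_abse ii)).
  exists (fine (\int[leb]_(t in `[0%R, X]) (norm1c (f1 t))%:E)).
    by rewrite fine_ge0// integral_ge0// => t _; rewrite lee_fin norm1c_ge0.
  move=> x x0 xX; have [if1 ->] := hf x x0; rewrite f00 add0r.
  rewrite (@le_trans _ _
    (fine (\int[leb]_(t in `[0%R, X]) (norm1c (f1 t))%:E)))//.
    have xX' : `[0, x] `<=` `[0, X].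
      by apply: subset_itvl; rewrite bnd_simp.
    rewrite -lee_fin fineK//.
    apply: (@le_trans _ _ (\int[leb]_(t in `[0%R, x]) (norm1c (f1 t))%:E)%E).
      apply: norm1c_cintegral_le => //; first exact: measurable_funS mN.
      - by move=> t _; exact: norm1c_ge0.
      - exact: aeW.
    apply: ge0_subset_integral => //; first exact/measurable_EFinP.
    by move=> t _; rewrite lee_fin norm1c_ge0.
  rewrite ler_peMr//; last by rewrite -expR0 ler_expR mulr_ge0// ltW.
  by rewrite fine_ge0// integral_ge0// => t _; rewrite lee_fin norm1c_ge0.
have bn n : norm1c (f X) <= M0 * expR (c * X) / 2 ^+ n.
  rewrite (_ : _ / _ = M0 / 2 ^+ n * expR (c * X)); last by ring.
  have : forall x : R, 0 <= x -> x <= X ->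
    norm1c (f x) <= M0 / 2 ^+ n * expR (c * x).
    elim: n => [|n IH] x x0 xX; first by rewrite expr0 divr1 bf0.
    rewrite exprSr invfM mulrA; apply: contract => //.
    by rewrite divr_ge0// exprn_ge0.
  by apply => //; exact: ltW.
(* If f(X) were nonzero, the bound by a constant over 2^n would fail for an integer n above the
   ratio of that constant to |f(X)|, since n < 2^n. *)
apply: norm1c_eq0; rewrite leNgt; apply/negP => fX0.
pose n := (Num.truncn (M0 * expR (c * X) / norm1c (f X))).+1.
have := truncnS_gt (M0 * expR (c * X) / norm1c (f X)); rewrite -/n.
rewrite ltr_pdivrMr// ltNge => /negP; apply.
have := bn n; rewrite ler_pdivlMr ?exprn_gt0// mulrC; apply: le_trans.
by rewrite ler_pM2r// -natrX ler_nat ltnW// ltn_expl.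
Qed.

(** The difference f - g has zero initial data, and boundedness of [q] turns its equation into |u''|
    <= L |u|. *)
Lemma scalar_solution_unique q l f g (a b a' b' : R[i]) :
  (exists K : R, forall x : R, 0 < x -> `|q x| <= K) ->
  scalar_solution q l f a b -> scalar_solution q l g a' b' ->
  a = a' -> b = b' -> forall x : R, 0 <= x -> f x = g x.
Proof.
move=> [K qK] hf hg aa' bb' x x0; rewrite -{}aa' -{}bb' in hg;
  have := scalar_solution_lin 1 (-1) hf hg.
rewrite !mul1r !mulN1r !subrr => -[f1 [f2 [h1 h2 e h10 h20]]].
pose L : R := `|K| + norm1c l.
have L0 : 0 <= L by rewrite addr_ge0// norm1c_ge0.
have := @second_order_ode_unique0 L _ f1 f2 L0 h1 h2 _ h10 h20 x x0.
rewrite mul1r mulN1r => /(_ _)/subr0_eq; apply.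
apply: ae_imply e => {x0}x e x0.
move: e => /(_ x0); set u := 1 * f x + -1 * g x => e.
rewrite (_ : f2 x = ((q x)%:C - l) * u); last first.
  by rewrite mulrBl -e; ring.
rewrite (le_trans (norm1cM _ _))// ler_wpM2r ?norm1c_ge0//.
rewrite (le_trans (norm1cD _ _))// lerD//.
  by rewrite /norm1c/= normr0 addr0 (le_trans (qK x x0))// ler_norm.
by case: (l) => r s; rewrite /norm1c/= !normrN.
Qed.

End linear_ode.
(** * The matrix equation *)

Section square_integrable.
Variable R : realType.
Notation TR := (measurableTypeR R).
Notation Re := complex.Re.
Notation Im := complex.Im.
Implicit Types f g : R -> R[i].

Lemma L2_eq f g : (forall x, 0 < x -> f x = g x) -> L2 f -> L2 g.
Proof.
move=> fg [[mr mi] fi].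
have fg' (x : TR) : x \in (`]0, +oo[%classic : set TR) -> f x = g x.
  by rewrite inE/= in_itv/= andbT => /fg.
split; first split.
- by apply: eq_measurable_fun mr => x /fg' ->.
- by apply: eq_measurable_fun mi => x /fg' ->.
- by apply: le_lt_trans fi; rewrite le_eqVlt; apply/orP; left; apply/eqP;
    apply: eq_integral => x /fg' ->.
Qed.

Lemma sqnormcM (u v : R[i]) : sqnormc (u * v) = sqnormc u * sqnormc v.
Proof. by rewrite /sqnormc Re_mulc Im_mulc; ring. Qed.

Lemma sqnormcD_le (u v : R[i]) :
  sqnormc (u + v) <= 2 * sqnormc u + 2 * sqnormc v.
Proof.
rewrite /sqnormc Re_addc Im_addc; have := sqr_ge0 (Re u - Re v).
by have := sqr_ge0 (Im u - Im v); rewrite !sqrrB !sqrrD; lra.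
Qed.

Lemma sqnormc_ge0 (u : R[i]) : 0 <= sqnormc u.
Proof. by rewrite addr_ge0 ?sqr_ge0. Qed.

Lemma cmeasurable_lin (c d : R[i]) (D : set TR) f g :
  cmeasurable D f -> cmeasurable D g ->
    cmeasurable D (fun x => c * f x + d * g x).
Proof.
move=> [fr fi] [gr gi]; split.
- under eq_fun do rewrite Re_addc !Re_mulc.
  by apply: measurable_funD; apply: measurable_funB; exact: measurable_funM.
- under eq_fun do rewrite Im_addc !Im_mulc.
  by apply: measurable_funD; apply: measurable_funD; exact: measurable_funM.
Qed.

Lemma measurable_sqnormc (D : set TR) f :
  cmeasurable D f -> measurable_fun D (fun x => sqnormc (f x)).
Proof. by move=> [fr fi]; apply: measurable_funD; exact: measurable_funX. Qed.

Lemma L2_lin (c d : R[i]) f g : L2 f -> L2 g -> L2 (fun x => c * f x + d * g x).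
Proof.
move=> [mf fi] [mg gi]; split; first exact: cmeasurable_lin.
have mD : measurable (`]0, +oo[%classic : set TR) by [].
have msf := measurable_sqnormc mf; have msg := measurable_sqnormc mg.
have k0 (e : R[i]) : 0 <= 2 * sqnormc e by rewrite mulr_ge0// sqnormc_ge0.
apply: (@le_lt_trans _ _ (\int[lebesgue_measure]_(x in `]0%R, +oo[)
  ((2 * sqnormc c)%:E * (sqnormc (f x))%:E + (2 * sqnormc d)%:E *
    (sqnormc (g x))%:E))%E).
  apply: ge0_le_integral => //.
  - by move=> x _; rewrite lee_fin sqnormc_ge0.
  - apply/measurable_EFinP;
    apply: (@measurable_sqnormc _ (fun x => c * f x + d * g x)).
    exact: cmeasurable_lin.
  - apply/measurable_EFinP.
    by apply: measurable_funD; exact: measurable_funM.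
  - move=> x _; rewrite -!EFinM -EFinD lee_fin -!mulrA -!sqnormcM.
    exact: sqnormcD_le.
rewrite ge0_integralD//; last 4 first.
- by move=> x _; rewrite -EFinM lee_fin mulr_ge0// sqnormc_ge0.
- by apply/measurable_EFinP; exact: measurable_funM.
- by move=> x _; rewrite -EFinM lee_fin mulr_ge0// sqnormc_ge0.
- by apply/measurable_EFinP; exact: measurable_funM.
rewrite !ge0_integralZl_EFin//; last 4 first.
- by move=> x _; rewrite lee_fin sqnormc_ge0.
- exact/measurable_EFinP.
- by move=> x _; rewrite lee_fin sqnormc_ge0.
- exact/measurable_EFinP.
by apply: lte_add_pinfty; rewrite lte_mul_pinfty// lee_fin.
Qed.

End square_integrable.

(** * The matrix M(z) in terms of the scalar values m(l) and m(-l) *)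

Section M_value.
Variable R : realType.
Notation C := R[i].
Implicit Types (q : R -> R) (omega : R) (alpha : option R) (z l : C).

Lemma mulmx22E (A B : 'M[C]_2) i j :
  (A *m B) i j = A i 0 * B 0 j + A i 1 * B 1 j.
Proof.
by rewrite mxE !big_ord_recl big_ord0 addr0; congr (_ + _ * _);
  congr (_ _ _); apply/val_inj.
Qed.

Lemma ord2P (P : 'I_2 -> Prop) : P 0 -> P 1 -> forall i, P i.
Proof.
move=> P0 P1 [[|[|//]] i2].
- by rewrite (_ : Ordinal i2 = 0)//; exact/val_inj.
- by rewrite (_ : Ordinal i2 = 1)//; exact/val_inj.
Qed.

(** With [bc_C_real], this matches the matrix boundary data with the initial data of the scalar
    solutions, so that rows of Phi and Theta can be compared with phi and theta. *)
Lemma bc_S_real alpha :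
  bc_S (omap (fun a : R => a%:C) alpha) = (sin_gamma alpha)%:C%:M.
Proof.
case: alpha => [a|] /=; last by rewrite raddf0.
by rewrite /sqnormc/= expr0n addr0.
Qed.

Lemma bc_C_real alpha :
  bc_C (omap (fun a : R => a%:C) alpha) = (cos_gamma alpha)%:C *: epsilon R.
Proof.
case: alpha => [a|] /=; last by rewrite scale1r.
rewrite /sqnormc/= expr0n addr0.
apply/matrixP; elim/ord2P; elim/ord2P; rewrite mxE mulmx22E !mxE/=.
all: rewrite ?oppr0 !(mul0r, mulr0, addr0, add0r, mul1r, mulr1) //.
all: by rewrite -[LHS]rmorphM/= mulrC.
Qed.

Section eigenvector_row.
Variables (q : R -> R) (omega : R) (z l : C).
(** As w = i omega, the hypothesis [lz] reads l^2 = z^2 - omega^2. *)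
Let w : C := 0 +i* omega.
Hypothesis lz : l ^+ 2 = z ^+ 2 + w ^+ 2.
Let p (x : R) : C := q x +i* omega.

(* (z, l - i omega) is a left eigenvector, for the eigenvalue l, of the matrix
   B = (i omega, z; z, - i omega) for which the system reads
   - F'' + q F = B F. *)
Lemma mx_solution_row (F : R -> 'M[C]_2) A B j : mx_solution p z F A B ->
  scalar_solution q l (fun x => z * F x 0 j + (l - w) * F x 1 j)
    (z * A 0 j + (l - w) * A 1 j) (z * B 1 j + (l - w) * B 0 j).
Proof.
move=> [F1 [F2 [hF hF1 e <- <-]]].
exists (fun x => z * F1 x 0 j + (l - w) * F1 x 1 j),
  (fun x => z * F2 x 0 j + (l - w) * F2 x 1 j); split => //.
- exact: (has_ac_derivative_lin z (l - w) (hF 0 j) (hF 1 j)).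
- exact: (has_ac_derivative_lin z (l - w) (hF1 0 j) (hF1 1 j)).
- apply: ae_imply e => x e x0; move: (e x0) => {}e.
  have pE : p x = (q x)%:C + w
    by apply/eqP; rewrite eq_complex/= addr0 add0r !eqxx.
  have pJ : (p x)^* = (q x)%:C - w.
    by apply/eqP; rewrite eq_complex/= oppr0 addr0 add0r !eqxx.
  move: (p x) e pE pJ => P e pE pJ.
  have {}e i : - (epsilon R *m F2 x) i j + (mx22 0 P P^* 0 *m F x) i j =
      z * F x i j.
    have := congr1 (fun M : 'M[C]_2 => M i j) e.
    by rewrite mxE [X in X + _]mxE [RHS]mxE.
  (* [epsilon] exchanges the rows: row 0 of the equation gives the second derivative of row 1 of F,
     and conversely. *)
  have := e 1; have := e 0.
  rewrite !mulmx22E !mxE/= pJ pE !(mul0r, mul1r, add0r, addr0) => e0 e1.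
  have {}e1 : F2 x 0 j = ((q x)%:C - w) * F x 0 j - z * F x 1 j
    by rewrite -e1; ring.
  have {}e0 : F2 x 1 j = ((q x)%:C + w) * F x 1 j - z * F x 0 j
    by rewrite -e0; ring.
  rewrite e0 e1; apply/eqP; rewrite -subr_eq0; apply/eqP.
  transitivity ((z ^+ 2 + w ^+ 2 - l ^+ 2) * F x 1 j); first by ring.
  by rewrite lz subrr mul0r.
- by rewrite !mulmx22E !mxE/=; ring.
Qed.

End eigenvector_row.
Lemma scalar_solutionZ q l (c : C) f (a b : C) :
  scalar_solution q l f a b ->
    scalar_solution q l (fun x => c * f x) (c * a) (c * b).
Proof.
move=> h; have := scalar_solution_lin c 0 h h; rewrite !mul0r !addr0.
by congr scalar_solution; apply/funext => x; rewrite mul0r addr0.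
Qed.

(* In terms of B = (i omega, z; z, - i omega), with B^2 = l^2, the right-hand
   side is m(B) epsilon, where
   m(B) = (m(l) - m(-l)) / (2 l) B + (m(l) + m(-l)) / 2. *)
Definition M_of_m (omega : R) (z l mp mm : C) : 'M[C]_2 :=
  let w := 0 +i* omega in
  let a := (mp - mm) / (2 * l) in let b := (mp + mm) / 2 in
  mx22 (a * z) (a * w + b) (- (a * w) + b) (a * z).

(** Let v = (z, l - i omega). By uniqueness for the scalar equation, v Phi = phi v and v Theta =
    theta v epsilon. The condition on N says v N = m v epsilon, so v (Theta - Phi N) = (theta - phi
    m) v epsilon, which is square integrable by the choice of m. *)
Lemma is_m_value_row q alpha omega z l (m : C) (Phi Theta : R -> 'M[C]_2) :
  (exists K : R, forall x : R, 0 < x -> `|q x| <= K) ->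
  l ^+ 2 = z ^+ 2 + (0 +i* omega) ^+ 2 -> is_m_value q alpha l m ->
  let S := bc_S (omap (fun a : R => a%:C) alpha) in
  let D := bc_C (omap (fun a : R => a%:C) alpha) in
  mx_solution (fun x => q x +i* omega) z Phi S (- D) ->
  mx_solution (fun x => q x +i* omega) z Theta D S ->
  forall N : 'M[C]_2,
  (forall j, z * N 0 j + (l - 0 +i* omega) * N 1 j =
     m * (z * epsilon R 0 j + (l - 0 +i* omega) * epsilon R 1 j)) ->
  forall j, L2 (fun x => z * (Theta x - Phi x *m N) 0 j
     + (l - 0 +i* omega) * (Theta x - Phi x *m N) 1 j).
Proof.
move=> qK lz [phi [theta [hphi htheta [L2m _]]]] S D hPhi hTheta N hN j.
set w : C := 0 +i* omega in lz hN *.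
have ePhi k x : 0 < x -> z * Phi x 0 k + (l - w) * Phi x 1 k =
    (z * (0 == k)%:R + (l - w) * (1 == k)%:R) * phi x.
  move=> x0; have h1 := mx_solution_row lz k hPhi.
  have h2 := scalar_solutionZ (z * (0 == k)%:R + (l - w) * (1 == k)%:R) hphi.
  apply: (scalar_solution_unique qK h1 h2 _ _ (ltW x0)).
  - by rewrite /S bc_S_real !mxE -/w; elim/ord2P: k {h1 h2} => /=; ring.
  - by rewrite /D bc_C_real !mxE rmorphN -/w; elim/ord2P: k {h1 h2} => /=; ring.
have eTheta x : 0 < x -> z * Theta x 0 j + (l - w) * Theta x 1 j =
    (z * epsilon R 0 j + (l - w) * epsilon R 1 j) * theta x.
  move=> x0; have h1 := mx_solution_row lz j hTheta.
  have h2 := scalar_solutionZ (z * epsilon R 0 j + (l - w) * epsilon R 1 j)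
    htheta.
  apply: (scalar_solution_unique qK h1 h2 _ _ (ltW x0)).
  - by rewrite /D bc_C_real !mxE -/w; ring.
  - by rewrite /S bc_S_real !mxE -/w; elim/ord2P: j {h1 h2} => /=; ring.
have := L2_lin (z * epsilon R 0 j + (l - w) * epsilon R 1 j) 0 L2m L2m.
apply: L2_eq => x x0.
have := ePhi 0 x x0; have := ePhi 1 x x0; rewrite /= => e1 e0.
transitivity (z * Theta x 0 j + (l - w) * Theta x 1 j
   - (z * Phi x 0 0 + (l - w) * Phi x 1 0) * N 0 j
   - (z * Phi x 0 1 + (l - w) * Phi x 1 1) * N 1 j); last first.
  have W i : (Theta x - Phi x *m N) i j =
      Theta x i j - (Phi x i 0 * N 0 j + Phi x i 1 * N 1 j).
    by rewrite mxE [X in _ + X]mxE mulmx22E.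
  by rewrite !W; ring.
rewrite eTheta// e0 e1 mulr1 mulr0 addr0 mulr0 mulr1 add0r.
transitivity ((z * epsilon R 0 j + (l - w) * epsilon R 1 j) * theta x
  - phi x * (z * N 0 j + (l - w) * N 1 j)); last by ring.
by rewrite hN; ring.
Qed.

(** [M_of_m] satisfies the row condition of [is_m_value_row] for both roots l and -l. The vectors
    (z, l - i omega) and (z, -l - i omega) are independent because l z is nonzero, so every entry of
    Theta - Phi N is square integrable, and uniqueness of M concludes. *)
Lemma is_M_valueE q alpha omega z l (mp mm : C) M :
  (exists K : R, forall x : R, 0 < x -> `|q x| <= K) ->
  z != 0 -> l != 0 -> l ^+ 2 = z ^+ 2 + (0 +i* omega) ^+ 2 ->
  is_m_value q alpha l mp -> is_m_value q alpha (- l) mm ->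
  is_M_value (fun x => q x +i* omega) (omap (fun a : R => a%:C) alpha) z M ->
  M = M_of_m omega z l mp mm.
Proof.
move=> qK z0 l0 lz hp hm [Phi [Th [hPhi hTh [_ uniqM]]]]; apply: uniqM.
set w : C := 0 +i* omega in lz *.
have lz' : (- l) ^+ 2 = z ^+ 2 + w ^+ 2 by rewrite sqrrN.
set N := M_of_m _ _ _ _ _.
have rowp := is_m_value_row qK lz hp hPhi hTh (N := N).
have rowm := is_m_value_row qK lz' hm hPhi hTh (N := N).
have zE : z ^+ 2 = l ^+ 2 - w ^+ 2 by rewrite lz addrK.
have Lp : forall j, L2 (fun x => z * (Th x - Phi x *m N) 0 j
     + (l - w) * (Th x - Phi x *m N) 1 j).
  apply: rowp; elim/ord2P; rewrite /N !mxE/= -/w !(mulr0, mulr1, addr0, add0r).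
  + transitivity ((mp - mm) / (2 * l) * (z ^+ 2) + (l - w) *
    (- ((mp - mm) / (2 * l) * w) + (mp + mm) / 2)).
      by ring.
    by rewrite zE; field; rewrite l0.
  + by field; rewrite l0.
have Lm : forall j, L2 (fun x => z * (Th x - Phi x *m N) 0 j
     + (- l - w) * (Th x - Phi x *m N) 1 j).
  apply: rowm; elim/ord2P; rewrite /N !mxE/= -/w !(mulr0, mulr1, addr0, add0r).
  + transitivity ((mp - mm) / (2 * l) * (z ^+ 2) + (- l - w) *
    (- ((mp - mm) / (2 * l) * w) + (mp + mm) / 2)).
      by ring.
    by rewrite zE; field; rewrite l0.
  + by field; rewrite l0.
move=> i j; elim/ord2P: i.
(* The coefficients, here and for the other row, invert the 2 by 2 system of [Lp] and [Lm], whose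
   determinant is -2 l z. *)
- have := L2_lin ((l + w) / (2 * l * z)) ((l - w) / (2 * l * z)) (Lp j) (Lm j).
  by apply: L2_eq => x _; field; rewrite l0 z0.
- have := L2_lin (2 * l)^-1 (- (2 * l)^-1) (Lp j) (Lm j).
  by apply: L2_eq => x _; field; rewrite l0.
Qed.

End M_value.

(** * Herglotz integrals *)

Section herglotz_kernel_integral.
Variable R : realType.
Notation TR := (measurableTypeR R).
Notation Re := complex.Re.
Notation Im := complex.Im.
Implicit Types (mu : {measure set TR -> \bar R}) (z : R[i]).

Lemma invcE (u : R[i]) :
  u^-1 = (Re u / sqnormc u) -i* (Im u / sqnormc u).
Proof. by case: u. Qed.

Lemma Im_inv_subc z (t : R) : Im (t%:C - z)^-1 = poisson (Re z) (Im z) t.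
Proof.
by case: z => x y; rewrite invcE/= /sqnormc /poisson/= !sub0r sqrrN mulNr opprK.
Qed.

Lemma Im_herglotz_kernel z (t : R) :
  Im (herglotz_kernel z t) = poisson (Re z) (Im z) t.
Proof. by rewrite /herglotz_kernel Im_addc Im_inv_subc/= oppr0 addr0. Qed.

Lemma subc_neq0 z (t : R) : Im z != 0 -> t%:C - z != 0.
Proof.
by case: z => x y /= y0; rewrite eq_complex/= negb_and sub0r oppr_eq0 y0 orbT.
Qed.

Lemma onePsqr_gt0 (t : R) : 0 < 1 + t ^+ 2.
Proof. by rewrite ltr_pwDl// sqr_ge0. Qed.

Lemma norm1c_inv_subc z (t : R) : Im z != 0 ->
  norm1c (t%:C - z)^-1 <= 2 / `|Im z|.
Proof.
case: z => x y /= y0; rewrite invcE /norm1c /sqnormc/= sub0r sqrrN normrN.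
have n0 : 0 < (t - x) ^+ 2 + y ^+ 2.
  by rewrite ltr_wpDl ?sqr_ge0// lt_neqAle eq_sym expf_neq0//= sqr_ge0.
rewrite !normrM normrN normfV (gtr0_norm n0) -mulrDl ler_pdivrMr//.
rewrite mulrAC ler_pdivlMr ?normr_gt0//
  -[(t - x) ^+ 2](real_normK (num_real _)).
rewrite -[y ^+ 2](real_normK (num_real _)).
by have := sqr_ge0 (`|t - x| - `|y|); have := normr_ge0 y; rewrite sqrrB; nra.
Qed.

Lemma norm1c_real (r : R) : norm1c r%:C = `|r|.
Proof. by rewrite /norm1c/= normr0 addr0. Qed.

(** The kernel equals (z + (1 + z^2) / (t - z)) / (1 + t^2), and 1 / (t - z) is bounded in t because
    z is not real. *)
Lemma norm1c_herglotz_kernel z : Im z != 0 -> exists2 K : R, 0 <= K &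
  forall t : R, norm1c (herglotz_kernel z t) <= K * (1 + t ^+ 2)^-1.
Proof.
move=> z0; exists (norm1c z + norm1c (1 + z ^+ 2) * (2 / `|Im z|)).
  by rewrite addr_ge0 ?mulr_ge0 ?norm1c_ge0// divr_ge0.
move=> t; have t1 := onePsqr_gt0 t.
rewrite (_ : herglotz_kernel z t =
  ((1 + t ^+ 2)^-1)%:C * (z + (1 + z ^+ 2) * (t%:C - z)^-1)).
  rewrite (le_trans (norm1cM _ _))// norm1c_real gtr0_norm ?invr_gt0// mulrC.
  rewrite ler_pM2r ?invr_gt0// (le_trans (norm1cD _ _))// lerD2l.
  rewrite (le_trans (norm1cM _ _))// ler_wpM2l ?norm1c_ge0//.
  exact: norm1c_inv_subc.
rewrite /herglotz_kernel rmorphM/= !fmorphV/= rmorphD/= rmorphXn/= rmorph1.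
field; rewrite subc_neq0//= (_ : _ + _ = (1 + t ^+ 2)%:C); last first.
  by rewrite rmorphD/= rmorphXn/= rmorph1.
by rewrite fmorph_eq0 gt_eqF.
Qed.

Lemma cintegrable_herglotz_bound mu (f : R -> R[i]) (K : R) :
  herglotz_measure mu ->
  cmeasurable setT f -> 0 <= K ->
  {ae mu, forall t : R, norm1c (f t) <= K * (1 + t ^+ 2)^-1} ->
  cintegrable mu setT f.
Proof.
move=> hmu [mr mi] K0 fK.
have mE : measurable_fun setT (fun t : TR => (K%:E * ((1 + t ^+ 2)^-1)%:E)%E).
  by apply: measurable_funeM; exact: measurable_inv1sqr.
have Kfin : (\int[mu]_t (K%:E * ((1 + t ^+ 2)^-1)%:E) < +oo)%E.
  rewrite ge0_integralZl_EFin//.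
  - by rewrite lte_mul_pinfty ?lee_fin.
  - by move=> t _; rewrite lee_fin invr_ge0 ltW// onePsqr_gt0.
  - exact: measurable_inv1sqr.
have key (g : R -> R) : measurable_fun (setT : set TR) g ->
    (forall t, `|g t| <= norm1c (f t)) -> mu.-integrable setT
      (fun t => (g t)%:E).
  move=> mg gf; apply/integrableP; split; first exact/measurable_EFinP.
  apply: le_lt_trans Kfin; apply: ae_ge0_le_integral => //.
  - by apply/measurable_EFinP/measurableT_comp.
  - by move=> t _; rewrite -EFinM lee_fin mulr_ge0// invr_ge0 ltW// onePsqr_gt0.
  - apply: ae_imply fK => t fK _; rewrite -EFinM lee_fin.
    exact: le_trans (gf t) fK.
by split; apply: key => // t; rewrite /norm1c ?lerDl ?lerDr.
Qed.

Lemma cmeasurableM (D : set TR) (f g : R -> R[i]) :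
  cmeasurable D f -> cmeasurable D g -> cmeasurable D (fun t => f t * g t).
Proof.
move=> [fr fi] [gr gi]; split.
- by under eq_fun do rewrite Re_mulc; apply: measurable_funB;
  exact: measurable_funM.
- by under eq_fun do rewrite Im_mulc; apply: measurable_funD;
  exact: measurable_funM.
Qed.

Lemma cmeasurable_herglotz_kernel z : Im z != 0 ->
  cmeasurable (setT : set TR) (herglotz_kernel z).
Proof.
case: z => x y /= y0.
have c (t : R) : {for t, continuous (fun t : R => ((t - x) ^+ 2 + y ^+ 2)^-1)}.
  apply: cvgV; first by rewrite gt_eqF// ltr_wpDl ?sqr_ge0// lt_neqAle eq_sym
    expf_neq0//= sqr_ge0.
  apply: cvgD; last exact: cvg_cst.
  apply: (@cvg_comp _ _ _ (fun t => t - x) (fun u : R => u ^+ 2));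
    last exact: exprn_continuous.
  by apply: cvgB; [exact: cvg_id|exact: cvg_cst].
have m : measurable_fun (setT : set TR)
  (fun t : R => ((t - x) ^+ 2 + y ^+ 2)^-1).
  by apply: continuous_measurable_fun => t; exact: c.
have m1 : measurable_fun (setT : set TR) (fun t : R => (1 + t ^+ 2)^-1).
  by apply/measurable_EFinP; exact: measurable_inv1sqr.
split.
- rewrite (_ : (fun t => _) =
  (fun t => (t - x) * ((t - x) ^+ 2 + y ^+ 2)^-1 - t * (1 + t ^+ 2)^-1)).
    apply: measurable_funB; apply: measurable_funM => //.
    by apply: measurable_funB.
  by apply/funext => t; rewrite /herglotz_kernel Re_addc invcE/= /sqnormc/=
    sub0r sqrrN.
- under eq_fun do rewrite Im_herglotz_kernel/=.
  by rewrite /poisson; apply: measurable_funM.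
Qed.

Lemma cintegrable_herglotz_kernelM mu z (g : R -> R[i]) (K : R) :
  herglotz_measure mu -> Im z != 0 -> cmeasurable setT g -> 0 <= K ->
  {ae mu, forall t : R, norm1c (g t) <= K} ->
  cintegrable mu setT (fun t => herglotz_kernel z t * g t).
Proof.
move=> hmu z0 mg K0 gK; have [Kz Kz0 kz] := norm1c_herglotz_kernel z0.
apply: (@cintegrable_herglotz_bound _ _ (Kz * K)) => //.
- by apply: cmeasurableM => //; exact: cmeasurable_herglotz_kernel.
- exact: mulr_ge0.
- apply: ae_imply gK => t gK; rewrite (le_trans (norm1cM _ _))//.
  by rewrite mulrAC ler_pM ?norm1c_ge0.
Qed.

Lemma cintegrable_herglotz_kernel mu z : herglotz_measure mu -> Im z != 0 ->
  cintegrable mu setT (herglotz_kernel z).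
Proof.
move=> hmu z0; have [Kz Kz0 kz] := norm1c_herglotz_kernel z0.
apply: (@cintegrable_herglotz_bound _ _ Kz) => //.
- exact: cmeasurable_herglotz_kernel.
- exact: aeW.
Qed.

End herglotz_kernel_integral.

(** * The entries of m(B) epsilon as Poisson integrals in the variable s *)

Section herglotz_change_of_variable.
Variable R : realType.
Notation TR := (measurableTypeR R).
Notation Re := complex.Re.
Notation Im := complex.Im.
Variables (omega : R) (z l : R[i]).
Let w : R[i] := 0 +i* omega.
Let s (t : R) := s_of omega t.
Let P (u : R) := poisson (Re z) (Im z) u.
Hypotheses (z0 : Im z != 0) (l0 : Im l != 0) (lz : l ^+ 2 = z ^+ 2 + w ^+ 2).

Let s_sqr t : s t ^+ 2 = t ^+ 2 + omega ^+ 2.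
Proof. by rewrite sqr_sqrtr// addr_ge0 ?sqr_ge0. Qed.

Let s_sqrC t : (s t)%:C ^+ 2 = t%:C ^+ 2 - w ^+ 2.
Proof.
rewrite -!rmorphXn/= s_sqr rmorphD/=; congr (_ + _).
by apply/eqP; rewrite eq_complex/= !mul0r !sub0r !mulr0 addr0 oppr0 opprK -expr2
  !eqxx.
Qed.

Let Nl0 : Im (- l) != 0.
Proof. by case: (l) l0 => a b /=; rewrite oppr_eq0. Qed.

Let l_neq0 : l != 0. Proof. by apply: contra_neq l0 => ->. Qed.

Let tBl t : t%:C - l != 0. Proof. exact: subc_neq0. Qed.

Let tDl t : t%:C + l != 0.
Proof. by have := subc_neq0 t Nl0; rewrite opprK. Qed.

Let sBz t : (s t)%:C - z != 0. Proof. exact: subc_neq0. Qed.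

Let NsBz t : - (s t)%:C - z != 0.
Proof. by rewrite -rmorphN; exact: subc_neq0. Qed.

Let sDz t : (s t)%:C + z != 0.
Proof. by rewrite -oppr_eq0 opprD. Qed.

Let denomE t : (t%:C - l) * (t%:C + l) = ((s t)%:C - z) * ((s t)%:C + z).
Proof. by rewrite -!subr_sqr s_sqrC lz; ring. Qed.

Let kernelB t : herglotz_kernel l t - herglotz_kernel (- l) t =
  2 * l / (((s t)%:C - z) * ((s t)%:C + z)).
Proof.
rewrite -denomE /herglotz_kernel opprK; move: (_ / (_ + _))%:C => r.
by field; rewrite tBl tDl.
Qed.

Let kernelD t : herglotz_kernel l t + herglotz_kernel (- l) t =
  2 * t%:C / (((s t)%:C - z) * ((s t)%:C + z)) - 2 * (t / (1 + t ^+ 2))%:C.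
Proof.
rewrite -denomE /herglotz_kernel opprK; move: (_ / (_ + _))%:C => r.
by field; rewrite tBl tDl.
Qed.

Let Im_realM (r : R) (u : R[i]) : Im (r%:C * u) = r * Im u.
Proof. by rewrite Im_mulc/= mul0r addr0. Qed.

(** Partial fractions: 2z / (s^2 - z^2) = 1 / (s - z) + 1 / (-s - z). *)
Let Im_sum t : Im (z / (((s t)%:C - z) * ((s t)%:C + z))) =
  2^-1 * (P (s t) + P (- s t)).
Proof.
rewrite (_ : _ / _ = (2^-1)%:C * (((s t)%:C - z)^-1 + ((- s t)%:C - z)^-1)).
  by rewrite Im_mulc/= mul0r addr0 Im_addc !Im_inv_subc.
rewrite rmorphN/= fmorphV/= rmorph_nat; field.
by rewrite sBz sDz NsBz.
Qed.

(** Partial fractions: 2s / (s^2 - z^2) = 1 / (s - z) - 1 / (-s - z). For s = 0 the convention r / 0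
    = 0 makes the right-hand side vanish, so r must vanish as well; it does for r = t and r = omega,
    as s = 0 forces t = omega = 0. *)
Let Im_diff t (r : R) : (s t = 0 -> r = 0) ->
  Im (r%:C / (((s t)%:C - z) * ((s t)%:C + z))) =
  r / (2 * s t) * (P (s t) - P (- s t)).
Proof.
have [st0 r0|st0 _] := eqVneq (s t) 0; first by rewrite r0// !mul0r.
rewrite (_ : _ / _ =
  (r / (2 * s t))%:C * (((s t)%:C - z)^-1 - ((- s t)%:C - z)^-1)).
  rewrite Im_mulc/= mul0r addr0 Im_addc Im_inv_subc; congr (_ * (_ + _)).
  by rewrite /P -(Im_inv_subc z); case: (_^-1).
have st0' : (s t)%:C != 0 by rewrite fmorph_eq0.
rewrite rmorphN !rmorphM/= fmorphV/= rmorphM/= rmorph_nat; field.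
by rewrite sBz sDz NsBz st0'.
Qed.

Let s_eq0 t : s t = 0 -> t = 0 /\ omega = 0.
Proof.
move=> st0; have := s_sqr t; rewrite st0 expr0n/= => /esym/eqP.
by rewrite paddr_eq0 ?sqr_ge0// !sqrf_eq0 => /andP[/eqP-> /eqP->].
Qed.

Variables (sigma : {measure set TR -> \bar R}) (c : R) (mp mm : R[i]).
Hypotheses (hsigma : herglotz_measure sigma)
  (mpE : mp = c%:C + cintegral sigma setT (herglotz_kernel l))
  (mmE : mm = c%:C + cintegral sigma setT (herglotz_kernel (- l))).

Let ikp := cintegrable_herglotz_kernel hsigma l0.
Let ikm := cintegrable_herglotz_kernel hsigma Nl0.

Let comb (d e : R[i]) (F : R -> R) :
  (forall t, Im (d * herglotz_kernel l t + e * herglotz_kernel (- l) t) =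
    F t) ->
  sigma.-integrable setT (fun t => (F t)%:E) /\
  Im (d * cintegral sigma setT (herglotz_kernel l)
      + e * cintegral sigma setT (herglotz_kernel (- l))) = \int[sigma]_t F t.
Proof.
move=> dF; have id := cintegrableZ d measurableT ikp.
have ie := cintegrableZ e measurableT ikm.
rewrite -!cintegralZ// -cintegralD//; split.
  have [_] := cintegrableD measurableT id ie.
  by apply: eq_integrable => // t _; rewrite dF.
by apply: eq_Rintegral => t _; rewrite dF.
Qed.

Lemma M_of_m_diag :
  sigma.-integrable setT (fun t => (2^-1 * (P (s t) + P (- s t)))%:E) /\
  Im (M_of_m omega z l mp mm 0 0) =
    \int[sigma]_t (2^-1 * (P (s t) + P (- s t))).
Proof.
have [|i e] := @comb (z / (2 * l)) (- (z / (2 * l)))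
  (fun t => 2^-1 * (P (s t) + P (- s t))).
  move=> t; rewrite -Im_sum mulNr -mulrBr kernelB; congr Im.
  by field; rewrite sBz sDz l_neq0.
split=> //; rewrite -e mxE/= mpE mmE; congr Im; field; exact: l_neq0.
Qed.

(** The sum of the off-diagonal entries is m(l) + m(-l). The constant c and the terms t / (1 + t^2)
    do not cancel here, but they are real and disappear from the imaginary part. *)
Lemma M_of_m_sym :
  sigma.-integrable setT (fun t => (t / (2 * s t) * (P (s t) - P (- s t)))%:E)
    /\
  Im (M_of_m omega z l mp mm 0 1 + M_of_m omega z l mp mm 1 0) =
  2 * \int[sigma]_t (t / (2 * s t) * (P (s t) - P (- s t))).
Proof.
have [|i e] := @comb 2^-1 2^-1 (fun t => t / (2 * s t) * (P (s t) - P (- s t))).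
  move=> t; rewrite -Im_diff; last by move=> /s_eq0[].
  rewrite -mulrDr kernelD.
  rewrite (_ : _ * _ =
    t%:C / (((s t)%:C - z) * ((s t)%:C + z)) - (t / (1 + t ^+ 2))%:C).
    by rewrite Im_addc/= oppr0 addr0.
  by move: (_ / (_ + _))%:C => r; field; rewrite sBz sDz.
split=> //; rewrite -{}e -Im_realM; transitivity (Im (mp + mm)); last first.
  rewrite -[RHS]add0r -[0](_ : Im (2 * c)%:C = 0)// -Im_addc mpE mmE; congr Im.
  by rewrite rmorphM/= rmorph_nat; field.
by congr Im; rewrite !mxE/=; field.
Qed.

(** The difference of the off-diagonal entries is i omega (m(l) - m(-l)) / l, and -Re(i u) = Im
    u. *)
Lemma M_of_m_skew :
  sigma.-integrable setT
    (fun t => (omega / (2 * s t) * (P (s t) - P (- s t)))%:E) /\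
  - Re (M_of_m omega z l mp mm 0 1 - M_of_m omega z l mp mm 1 0) =
  2 * \int[sigma]_t (omega / (2 * s t) * (P (s t) - P (- s t))).
Proof.
have [|i e] := @comb (omega%:C / (2 * l)) (- (omega%:C / (2 * l)))
    (fun t => omega / (2 * s t) * (P (s t) - P (- s t))).
  move=> t; rewrite -Im_diff; last by move=> /s_eq0[].
  rewrite mulNr -mulrBr kernelB; congr Im.
  by field; rewrite sBz sDz l_neq0.
split=> //; rewrite -{}e -Im_realM -ImiRe -[LHS]mulN1r.
have wE : w = 'i%C * omega%:C.
  by apply/eqP; rewrite eq_complex/= !(mul0r, mulr0, mul1r, add0r, oppr0) !eqxx.
have -> : M_of_m omega z l mp mm 0 1 - M_of_m omega z l mp mm 1 0 =
  (mp - mm) / l * w.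
  by rewrite !mxE/= -/w; field.
rewrite -Im_realM wE rmorphN rmorph1 rmorph_nat mpE mmE; congr Im.
set A := cintegral _ _ _; set B := cintegral _ _ _.
rewrite (_ : -1 * _ = - 'i%C ^+ 2 * ((A - B) / l * omega%:C)); last by ring.
by rewrite sqr_i; field.
Qed.

End herglotz_change_of_variable.

(** * The same three quantities of M(z) as Poisson integrals against nu *)

Section spectral_pair_integral.
Variable R : realType.
Notation TR := (measurableTypeR R).
Notation Re := complex.Re.
Notation Im := complex.Im.

(** Hermitian symmetry is what removes the constant term from Im M_00, Im (M_01 + M_10) and Re (M_01
    - M_10). *)
Lemma RemxJ (M : 'M[R[i]]_2) i j : Remx M j i = (Remx M i j)^*.
Proof.
rewrite !mxE [RHS]rmorphM fmorphV rmorph_nat rmorphD; congr (_ * _).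
by rewrite [X in _ = _ + X]conjcK addrC.
Qed.

Lemma sqnormc_le1 (u : R[i]) : `|u| <= 1 -> sqnormc u <= 1.
Proof. by move=> u1; rewrite -lecR add_Re2_Im2 exprn_ile1. Qed.

Lemma norm_Re_le1 (u : R[i]) : `|u| <= 1 -> `|Re u| <= 1.
Proof.
move=> /sqnormc_le1; rewrite /sqnormc => u1;
  rewrite -[leRHS](@normr1 R) -ler_sqr ?nnegrE//.
by rewrite !real_normK ?num_real// expr1n (le_trans _ u1)// lerDl sqr_ge0.
Qed.

Lemma norm_Im_le1 (u : R[i]) : `|u| <= 1 -> `|Im u| <= 1.
Proof.
move=> /sqnormc_le1; rewrite /sqnormc => u1;
  rewrite -[leRHS](@normr1 R) -ler_sqr ?nnegrE//.
by rewrite !real_normK ?num_real// expr1n (le_trans _ u1)// lerDr sqr_ge0.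
Qed.

Variables (nu : {measure set TR -> \bar R}) (psi : R -> R[i]) (z : R[i]).
Hypotheses (hnu : herglotz_measure nu) (mpsi : cmeasurable setT psi).
Hypothesis psi1 : {ae nu, forall t : R, `|psi t| <= 1}.
Hypothesis z0 : Im z != 0.
Let P (u : R) := poisson (Re z) (Im z) u.
Let k := herglotz_kernel z.
Variables (Mi M : 'M[R[i]]_2).
Hypothesis ME : M = Remx Mi + Sigma_integral nu psi k.

Let cmeasurable_real (g : R -> R) : measurable_fun (setT : set TR) g ->
  cmeasurable (setT : set TR) (fun t => (g t)%:C).
Proof. by move=> mg; split. Qed.

Let ik : cintegrable nu setT k. Proof. exact: cintegrable_herglotz_kernel. Qed.

Let ikRe : cintegrable nu setT (fun t => k t * (Re (psi t))%:C).
Proof.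
apply: (@cintegrable_herglotz_kernelM _ _ _ _ 1) => //.
  by apply: cmeasurable_real; case: mpsi.
by apply: ae_imply psi1 => t; rewrite norm1c_real; exact: norm_Re_le1.
Qed.

Let ikIm : cintegrable nu setT (fun t => k t * (Im (psi t))%:C).
Proof.
apply: (@cintegrable_herglotz_kernelM _ _ _ _ 1) => //.
  by apply: cmeasurable_real; case: mpsi.
by apply: ae_imply psi1 => t; rewrite norm1c_real; exact: norm_Im_le1.
Qed.

Let Im_kM t (r : R) : Im (k t * r%:C) = P t * r.
Proof. by rewrite Im_mulc/= mulr0 add0r Im_herglotz_kernel. Qed.

(** Both kernel and psi are complex, so Im (k psi) alone mixes the two parts of psi. Splitting psi,
    and its conjugate in [psiJE], lets M_01 + M_10 isolate Re psi and M_01 - M_10 isolate Im psi. *)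
Let psiE t : k t * psi t = k t * (Re (psi t))%:C +
  'i%C * (k t * (Im (psi t))%:C).
Proof. by rewrite {1}[psi t]complexE; ring. Qed.

Let psiJE t : k t * (psi t)^* = k t * (Re (psi t))%:C +
  (- 'i%C) * (k t * (Im (psi t))%:C).
Proof.
case: (psi t) => a b; case: (k t) => c d; apply/eqP; rewrite eq_complex/=.
by apply/andP; split; apply/eqP; ring.
Qed.

Let M01 : M 0 1 = Remx Mi 0 1 +
  (cintegral nu setT (fun t => k t * (Re (psi t))%:C)
  + 'i%C * cintegral nu setT (fun t => k t * (Im (psi t))%:C)).
Proof.
rewrite ME mxE; congr (_ + _); rewrite [LHS]mxE/=; under eq_fun do rewrite psiE.
by rewrite cintegralD// ?cintegralZ//; exact: cintegrableZ.
Qed.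

Let M10 : M 1 0 = Remx Mi 1 0 +
  (cintegral nu setT (fun t => k t * (Re (psi t))%:C)
  + (- 'i%C) * cintegral nu setT (fun t => k t * (Im (psi t))%:C)).
Proof.
rewrite ME mxE; congr (_ + _); rewrite [LHS]mxE/=;
  under eq_fun do rewrite psiJE.
by rewrite cintegralD// ?cintegralZ//; exact: cintegrableZ.
Qed.

Lemma spectral_pair_diag :
  nu.-integrable setT (fun t => (P t)%:E) /\ Im (M 0 0) = \int[nu]_t P t.
Proof.
split; first by have [_] := ik; apply: eq_integrable => // t _;
  rewrite Im_herglotz_kernel.
have R00 : Im (Remx Mi 0 0) = 0.
  have /eqP := RemxJ Mi 0 0; rewrite eq_complex => /andP[_ /eqP].
  by case: (Remx Mi 0 0) => a b /= bb; lra.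
rewrite ME mxE Im_addc R00 add0r mxE/=.
by apply: eq_Rintegral => t _; rewrite Im_herglotz_kernel.
Qed.

Lemma spectral_pair_sym :
  nu.-integrable setT (fun t => (P t * Re (psi t))%:E) /\
  Im (M 0 1 + M 1 0) = 2 * \int[nu]_t (P t * Re (psi t)).
Proof.
split; first by have [_] := ikRe; apply: eq_integrable => // t _; rewrite Im_kM.
rewrite M01 M10; set A := cintegral _ _ _; set B := cintegral _ _ _.
rewrite (_ : _ + _ = (Remx Mi 0 1 + Remx Mi 1 0) + 2%:C * A); last first.
  by rewrite rmorph_nat; ring.
rewrite Im_addc (_ : Im (Remx Mi 0 1 + _) = 0) ?add0r; last first.
  by rewrite (RemxJ Mi 0 1); case: (Remx Mi 0 1) => a b /=; rewrite subrr.
rewrite [LHS]Im_mulc/= mul0r addr0; congr (_ * _).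
by apply: eq_Rintegral => t _; rewrite Im_kM.
Qed.

Lemma spectral_pair_skew :
  nu.-integrable setT (fun t => (P t * Im (psi t))%:E) /\
  - Re (M 0 1 - M 1 0) = 2 * \int[nu]_t (P t * Im (psi t)).
Proof.
split; first by have [_] := ikIm; apply: eq_integrable => // t _; rewrite Im_kM.
rewrite M01 M10; set A := cintegral _ _ _; set B := cintegral _ _ _.
rewrite (_ : _ - _ = (Remx Mi 0 1 - Remx Mi 1 0) + (2%:C * B) * 'i%C);
  last first.
  by rewrite rmorph_nat; ring.
rewrite Re_addc (_ : Re (Remx Mi 0 1 - _) = 0) ?add0r; last first.
  by rewrite (RemxJ Mi 0 1); case: (Remx Mi 0 1) => a b /=; rewrite subrr.
rewrite ReiNIm opprK [LHS]Im_mulc/= mul0r addr0; congr (_ * _).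
by apply: eq_Rintegral => t _; rewrite Im_kM.
Qed.

End spectral_pair_integral.

(** * Identification of the measures *)

Section measure_identity.
Variable R : realType.
Notation TR := (measurableTypeR R).
Variables (omega : R) (sigma nu : {measure set TR -> \bar R}).
Let s (t : R) := s_of omega t.

Lemma s_of_ge0 t : 0 <= s t. Proof. exact: sqrtr_ge0. Qed.

Lemma sqr_s_of t : s t ^+ 2 = t ^+ 2 + omega ^+ 2.
Proof. by rewrite sqr_sqrtr// addr_ge0 ?sqr_ge0. Qed.

Lemma s_of_geN t : `|omega| <= s t.
Proof.
rewrite -ler_sqr ?nnegrE ?s_of_ge0// sqr_s_of real_normK ?num_real//.
by rewrite lerDr sqr_ge0.
Qed.

Lemma s_of_ge_norm t : `|t| <= s t.
Proof.
rewrite -ler_sqr ?nnegrE ?s_of_ge0// sqr_s_of real_normK ?num_real//.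
by rewrite lerDl sqr_ge0.
Qed.

Lemma measurable_s_of : measurable_fun setT (s : TR -> TR).
Proof.
apply: (@measurableT_comp _ _ _ _ _ _ (@Num.sqrt R : TR -> TR)) => //.
  by apply: continuous_measurable_fun; exact: sqrt_continuous.
by apply: measurable_funD => //; exact: measurable_funX.
Qed.

(* [powR u (-1)] is [u^-1] also at [u = 0], where both are [0]. *)
Lemma measurable_inv2s :
  measurable_fun (setT : set TR) (fun t : R => (2 * s t)^-1).
Proof.
rewrite (_ : (fun t => _) = (fun t => (2 * s t) `^ (-1))); last first.
  by apply/funext => t; rewrite powR_inv1// mulr_ge0// s_of_ge0.
apply: (@measurableT_comp _ _ _ _ _ _ (fun u : TR => u `^ (-1) : TR)) => //.
by apply: measurable_funM => //; exact: measurable_s_of.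
Qed.

Hypothesis hnu : herglotz_measure nu.
Hypothesis diag : forall x y : R, 0 < y ->
  [/\ nu.-integrable setT (fun t => (poisson x y t)%:E),
      sigma.-integrable setT
        (fun t => (2^-1 * (poisson x y (s t) + poisson x y (- s t)))%:E) &
      \int[nu]_t poisson x y t =
      \int[sigma]_t (2^-1 * (poisson x y (s t) + poisson x y (- s t)))].

Lemma EFin_Rintegral d (T : measurableType d) (mu : {measure set T -> \bar R})
    (D : set T) (f : T -> R) : measurable D ->
      mu.-integrable D (fun t => (f t)%:E) ->
  (\int[mu]_(t in D) f t)%:E = (\int[mu]_(t in D) (f t)%:E)%E.
Proof. by move=> mD iF; rewrite fineK//; exact: integrable_fin_num. Qed.

Lemma measurable_s_preimage (A : set TR) : measurable A ->
  measurable (s @^-1` A : set TR).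
Proof.
by move=> mA; rewrite -[X in measurable X]setTI; exact: measurable_s_of.
Qed.

Lemma measurable_Ns_of : measurable_fun setT ((fun t => - s t) : TR -> TR).
Proof. by apply: measurable_funN; exact: measurable_s_of. Qed.

Lemma measurable_Ns_preimage (A : set TR) : measurable A ->
  measurable ((fun t => - s t) @^-1` A : set TR).
Proof.
by move=> mA; rewrite -[X in measurable X]setTI; exact: measurable_Ns_of.
Qed.

(** The density is (s + u) / (2s), or 1/2 by convention when s = 0. Its sign allows inversion for
    positive measures. *)
Let half_ge0 (u t : R) : `|u| <= s t -> 0 <= 2^-1 + u / (2 * s t).
Proof.
move=> us; have [st0|st0] := eqVneq (s t) 0;
  first by rewrite st0 mulr0 invr0 mulr0 addr0.
have st : 0 < s t by rewrite lt_neqAle eq_sym st0 s_of_ge0.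
rewrite (_ : _ + _ = (s t + u) / (2 * s t)); last by field.
by rewrite divr_ge0 ?mulr_ge0 ?s_of_ge0//; move: us;
  rewrite ler_norml => /andP[]; lra.
Qed.

Lemma nu_transfer (A : set TR) : measurable A ->
  nu A = ((2^-1)%:E * sigma (s @^-1` A) +
          (2^-1)%:E * sigma ((fun t => (- s t)%R) @^-1` A))%E.
Proof.
move=> mA.
have key := @poisson_transfer R nu sigma s (fun t => - s t) (fun=> 1)
  (fun=> 2^-1)
  (fun=> 2^-1) measurable_s_of measurable_Ns_of.
have ic (mu : {measure set TR -> \bar R}) (D : set TR) (c : R) : measurable D ->
  (\int[mu]_(t in D) c%:E = c%:E * mu D)%E by move=> mD; exact: integral_cst.
rewrite -[LHS]mul1e -!ic//;
  [|exact: measurable_Ns_preimage|exact: measurable_s_preimage].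
apply: key => //.
  by under eq_integral do rewrite mulr1.
move=> x y y0; have [inu isigma e] := diag x y0.
under eq_integral do rewrite mulr1.
rewrite -EFin_Rintegral// e EFin_Rintegral//.
by apply: eq_integral => t _; rewrite mulrDr mulrC [X in _ + X]mulrC.
Qed.

Variables (g r : R -> R).
Hypotheses (mg : measurable_fun (setT : set TR) g)
  (mr : measurable_fun (setT : set TR) r).
Hypothesis g1 : {ae nu, forall t : R, `|g t| <= 1}.
Hypothesis rs : forall t, `|r t| <= s t.
Hypothesis offdiag : forall x y : R, 0 < y ->
  [/\ nu.-integrable setT (fun t => (poisson x y t * g t)%:E),
      sigma.-integrable setT
        (fun t => (r t / (2 * s t) *
          (poisson x y (s t) - poisson x y (- s t)))%:E) &
      \int[nu]_t (poisson x y t * g t) =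
      \int[sigma]_t
        (r t / (2 * s t) * (poisson x y (s t) - poisson x y (- s t)))].

(* Clipped since [1 + g] is nonnegative only almost everywhere. *)
Let g1p t := Num.max 0 (1 + g t).

Let mg1p : measurable_fun (setT : set TR) g1p.
Proof. by apply: measurable_maxr => //; exact: measurable_funD. Qed.

Let g1pE : {ae nu, forall t : R, g1p t = 1 + g t}.
Proof.
apply: ae_imply g1 => t; rewrite ler_norml => /andP[gt _].
by rewrite /g1p max_r//; lra.
Qed.

Let integral_g1p (x y : R) : 0 < y ->
  (\int[nu]_t (poisson x y t * g1p t)%:E =
   (\int[nu]_t (poisson x y t + poisson x y t * g t)%R)%:E)%E.
Proof.
move=> y0; have [inu _ _] := diag x y0; have [jnu _ _] := offdiag x y0.
rewrite EFin_Rintegral//; last exact: (integrableD measurableT inu jnu).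
apply: ae_eq_integral => //.
- apply/measurable_EFinP/measurable_funM => //.
  by apply/measurable_EFinP; exact: measurable_poisson.
- by apply/measurable_EFinP/measurable_funD; apply/measurable_EFinP;
    [exact: measurable_int inu|exact: measurable_int jnu].
- by apply: ae_imply g1pE => t -> _; congr EFin; ring.
Qed.

Let mrs : measurable_fun (setT : set TR) (fun t => r t / (2 * s t)).
Proof. by apply: measurable_funM => //; exact: measurable_inv2s. Qed.

(** Adding the identities [diag] and [offdiag] and collecting the kernels at s and at -s gives the
    densities 1/2 + r / (2s) and 1/2 - r / (2s). *)
Let g1_transfer (A : set TR) : measurable A ->
  (\int[nu]_(t in A) (g1p t)%:E =
  \int[sigma]_(t in s @^-1` A) (2^-1 + r t / (2 * s t))%:E +
  \int[sigma]_(t in (fun t => (- s t)%R) @^-1` A)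
    (2^-1 - r t / (2 * s t))%:E)%E.
Proof.
move: A; apply: (@poisson_transfer R nu sigma s (fun t => - s t) g1p
  (fun t => 2^-1 + r t / (2 * s t)) (fun t => 2^-1 - r t / (2 * s t))) => //.
- exact: measurable_s_of.
- exact: measurable_Ns_of.
- exact: measurable_funD.
- exact: measurable_funB.
- by move=> t; rewrite le_max lexx.
- by move=> t; exact: half_ge0.
- by move=> t; rewrite -mulNr; apply: half_ge0; rewrite normrN.
- under eq_integral => t _.
    rewrite (_ : (1 + t ^+ 2)^-1 = poisson 0 1 t); last first.
      by rewrite /poisson subr0 expr1n div1r addrC.
    over.
  by rewrite integral_g1p// ltry.
- move=> x y y0; have [inu isigma e] := diag x y0;
  have [jnu jsigma f] := offdiag x y0.
  have jD := integrableD measurableT isigma jsigma.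
  rewrite integral_g1p// RintegralD// e f -RintegralD// EFin_Rintegral//.
  by apply: eq_integral => t _; congr EFin; ring.
Qed.

Lemma integrable_ae_bounded d (T : measurableType d)
  (mu : {measure set T -> \bar R})
    (D : set T) (f : T -> R) (c : R) : measurable D -> (mu D < +oo)%E ->
  measurable_fun D f -> 0 <= c -> {ae mu, forall t, `|f t| <= c} ->
  mu.-integrable D (fun t => (f t)%:E).
Proof.
move=> mD Doo mf c0 fc; apply/integrableP; split; first exact/measurable_EFinP.
apply: (@le_lt_trans _ _ (\int[mu]_(t in D) (cst c%:E t))%E).
  apply: ae_ge0_le_integral => //.
  - by apply/measurable_EFinP/measurableT_comp.
  - by apply: ae_imply fc => t fc _; rewrite lee_fin.
by rewrite integral_cst// lte_mul_pinfty.
Qed.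

Lemma norm_div2s_le1 t : `|r t / (2 * s t)| <= 1.
Proof.
have [st0|st0] := eqVneq (s t) 0; first by rewrite st0 mulr0 invr0 mulr0 normr0.
have st : 0 < s t by rewrite lt_neqAle eq_sym st0 s_of_ge0.
rewrite normrM normfV (gtr0_norm (mulr_gt0 _ _))// ler_pdivrMr ?mulr_gt0//.
by rewrite mul1r (le_trans (rs t))// mulr_natl mulr2n lerDl ltW.
Qed.

Lemma sigma_preimage_lty (A : set TR) : measurable A -> (nu A < +oo)%E ->
  (sigma (s @^-1` A) < +oo /\ sigma ((fun t => (- s t)%R) @^-1` A) < +oo)%E.
Proof.
move=> mA; rewrite nu_transfer// => nuA.
have half (u v : \bar R) : (0 <= u -> 0 <= v ->
    (2^-1)%:E * u + (2^-1)%:E * v < +oo -> u < +oo)%E.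
  case: u => [u| |] // _ v0; rewrite ?ltry//.
  rewrite mulry gtr0_sg ?invr_gt0// mul1e addye//.
  by case: v v0 => // ; rewrite mulry gtr0_sg ?invr_gt0// mul1e.
split; first by apply: half nuA; exact: measure_ge0.
by rewrite addeC in nuA; apply: half nuA; exact: measure_ge0.
Qed.

(** Subtract [nu_transfer] from [g1_transfer]; finiteness of nu(A) makes all terms finite. *)
Lemma offdiag_transfer (A : set TR) : measurable A -> (nu A < +oo)%E ->
  \int[nu]_(t in A) g t = \int[sigma]_(t in s @^-1` A) (r t / (2 * s t))
    - \int[sigma]_(t in (fun t => - s t) @^-1` A) (r t / (2 * s t)).
Proof.
move=> mA nuA; have [S1oo S2oo] := sigma_preimage_lty mA nuA.
have mS1 := measurable_s_preimage mA; have mS2 := measurable_Ns_preimage mA.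
have ic (mu : {measure set TR -> \bar R}) (D : set TR) (c : R) : measurable D ->
    (mu D < +oo)%E -> mu.-integrable D (EFin \o (fun=> c)).
  move=> mD Doo; apply: (@integrable_ae_bounded _ _ _ _ (fun=> c) `|c|) => //.
  exact: aeW.
have ig : nu.-integrable A (EFin \o g).
  by apply: (@integrable_ae_bounded _ TR nu A g 1) => //;
    exact: measurable_funTS.
have ir (D : set TR) : measurable D -> (sigma D < +oo)%E ->
    sigma.-integrable D (EFin \o (fun t => r t / (2 * s t))).
  move=> mD Doo;
    apply: (@integrable_ae_bounded _ TR sigma D (fun t => r t / (2 * s t)) 1)
    => //.
    exact: measurable_funTS.
  by apply: aeW => t; exact: norm_div2s_le1.
have := g1_transfer mA.
have -> : (\int[nu]_(t in A) (g1p t)%:E = \int[nu]_(t in A) (1 + g t)%:E)%E.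
  apply: ae_eq_integral => //.
  - by apply/measurable_EFinP; exact: measurable_funTS.
  - by apply/measurable_EFinP/measurable_funTS; exact: measurable_funD.
  - by apply: ae_imply g1pE => t -> _.
rewrite -!EFin_Rintegral//; last 3 first.
- exact: (integrableB mS2 (ic sigma _ 2^-1 mS2 S2oo) (ir _ mS2 S2oo)).
- exact: (integrableD mS1 (ic sigma _ 2^-1 mS1 S1oo) (ir _ mS1 S1oo)).
- exact: (integrableD mA (ic nu A 1 mA nuA) ig).
rewrite RintegralB// ?RintegralD//; do ?[exact: ic|exact: ir].
rewrite !Rintegral_cst// -EFinD => -[]; rewrite nu_transfer//.
have S1fin : sigma (s @^-1` A) \is a fin_num by rewrite ge0_fin_numE.
have S2fin : sigma ((fun t => - s t) @^-1` A) \is a fin_num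
  by rewrite ge0_fin_numE.
rewrite fineD ?fineM ?fin_numM//=; lra.
Qed.

End measure_identity.

(** * Folding the preimages under s and -s onto the half-line of nonnegative l *)

Section fold_reflection.
Variable R : realType.
Notation TR := (measurableTypeR R).
Variables (omega : R) (sigma : {measure set TR -> \bar R}) (B : set TR).
Let s (t : R) := s_of omega t.
Hypotheses (mB : measurable B) (Bomega : B `<=` `[ `|omega|, +oo[).

Let S1 : set TR := s @^-1` B.
Let S2 : set TR := (fun t => - s t) @^-1` B.
Let Pre : set TR := s_preimage omega B.
Let NPre : set TR := (-%R : TR -> TR) @^-1` Pre.
Let Neg : set TR := S1 `&` `]-oo, 0[.
Let Z : set TR := S1 `&` [set 0].

Let mS1 : measurable S1. Proof. exact: measurable_s_preimage. Qed.

Let mNeg : measurable Neg. Proof. exact: measurableI. Qed.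

Let mZ : measurable Z. Proof. exact: measurableI. Qed.

Let PreE : Pre = S1 `&` `[0, +oo[.
Proof.
by apply/seteqP; split => t /=; rewrite in_itv/= andbT => -[].
Qed.

Let mPre : measurable Pre. Proof. by rewrite PreE; exact: measurableI. Qed.

Let s_ofN t : s (- t) = s t. Proof. by rewrite /s /s_of sqrrN. Qed.

Let S1N t : S1 (- t) = S1 t. Proof. by rewrite /S1/= s_ofN. Qed.

Let s0 : s 0 = `|omega|.
Proof. by rewrite /s /s_of expr0n add0r sqrtr_sqr. Qed.

Let NPreE : NPre = Neg `|` Z.
Proof.
rewrite /NPre PreE; apply/seteqP; split => t /=;
  rewrite !in_itv/= andbT oppr_ge0 S1N.
- move=> [Bt]; rewrite le_eqVlt => /predU1P[t0|t0]; [by right|left].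
  by split => //=; rewrite in_itv.
- move=> [[Bt]|[Bt t0]].
    by rewrite /= in_itv/= => t0; split => //; exact: ltW.
  by split => //; rewrite t0.
Qed.

Let S1E : S1 = Pre `|` Neg.
Proof.
rewrite PreE /Neg -setIUr; apply/esym/setIidl => t _ /=.
by rewrite !in_itv/= andbT; have [t0|t0] := leP 0 t; [left|right].
Qed.

Let mNPre : measurable NPre. Proof. by rewrite NPreE; exact: measurableU. Qed.

Let PreNeg : Pre `&` Neg = set0.
Proof.
rewrite PreE; apply/seteqP; split => t //= [[_]] /[swap] -[_].
by rewrite /= !in_itv/= andbT leNgt => ->.
Qed.

Let NegZ : Neg `&` Z = set0.
Proof.
apply/seteqP; split => t //= [[_]] /[swap] -[_] ->.
by rewrite /= in_itv/= ltxx.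
Qed.

(** [Pre] and [NPre] are the parts t >= 0 and t <= 0 of [S1]; they overlap in [Z], which the
    right-hand sides of the formulas thus count twice. Either -s also reaches B, only at t = 0 and
    only if omega = 0, and [S2] supplies the second copy of [Z], or the surplus is sigma-null. *)
Let omega_cases : (B `|omega| -> omega = 0 \/ sigma [set 0] = 0%E) ->
  omega = 0 /\ S2 = Z \/ S2 = set0 /\ sigma Z = 0%E.
Proof.
move=> hB; have [om0|om0] := eqVneq omega 0.
  left; split => //; apply/seteqP; split => t.
    move=> Bt; have := Bomega Bt; rewrite /= in_itv/= andbT om0 normr0 oppr_ge0.
    move=> st; have st0 : s t = 0 by apply/eqP; rewrite eq_le st s_of_ge0.
    have t0 : t = 0.
      by apply/eqP; rewrite -normr_le0 -st0; exact: s_of_ge_norm.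
    by split => //; rewrite /S1 /= st0 -oppr0 -st0.
  move=> [Bt t0]; rewrite /S2/= t0 s0 om0 normr0 oppr0.
  by move: Bt; rewrite /S1/= t0 s0 om0 normr0.
right; split.
  apply/seteqP; split => t //= Bt; have := Bomega Bt; rewrite /= in_itv/= andbT.
  by rewrite leNgt => /negP; apply;
    rewrite (@le_lt_trans _ _ 0) ?oppr_le0 ?s_of_ge0 ?normr_gt0.
have [Bo|nBo] := pselect (B `|omega|).
  have [om0'|z] := hB Bo; first by rewrite om0' eqxx in om0.
  by apply: (subset_measure0 mZ _ _ z) => // t [].
rewrite (_ : Z = set0) ?measure0//; apply/seteqP; split => t //= -[Bt t0].
by apply: nBo; rewrite -s0 -t0.
Qed.

Hypothesis hB : B `|omega| -> omega = 0 \/ sigma [set 0] = 0%E.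

Lemma nu_rhsE : ((2^-1)%:E * sigma S1 + (2^-1)%:E * sigma S2 =
  nu_rhs sigma omega B)%E.
Proof.
rewrite -ge0_muleDr ?measure_ge0// /nu_rhs; congr (_ * _)%E.
have -> : sigma S2 = sigma Z.
  by have [[_ ->//]|[-> ->]] := omega_cases hB; rewrite measure0.
rewrite /reflected /pushforward -/Pre -/NPre NPreE S1E !measureU//.
by rewrite addeA.
Qed.

(** After cancellation, minus the integral over [S2] has to equal the integral over [Z]. If omega =
    0 these sets coincide and the signs are opposite, which is consistent because the integrand
    vanishes at 0. *)
Lemma fold_integral (r : R -> R) : measurable_fun (setT : set TR) r ->
  (forall t, `|r t| <= s t) -> (sigma S1 < +oo)%E -> (omega = 0 -> r 0 = 0) ->
  \int[sigma]_(t in S1) (r t / (2 * s t)) -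
    \int[sigma]_(t in S2) (r t / (2 * s t)) =
  \int[sigma]_(t in Pre) (r t / (2 * s t)) +
    \int[sigma]_(t in NPre) (r t / (2 * s t)).
Proof.
move=> mr rs S1oo r0; set f := fun t => r t / (2 * s t).
have mf (D : set TR) : measurable_fun D f.
  apply: measurable_funTS; apply: measurable_funM => //;
    exact: measurable_inv2s.
have iS1 : sigma.-integrable S1 (EFin \o f).
  apply: (@integrable_ae_bounded _ _ TR sigma S1 f 1) => //.
  by apply: aeW => t; exact: norm_div2s_le1.
have iNPre : sigma.-integrable NPre (EFin \o f).
  apply: integrableS iS1 => //; rewrite NPreE => t [[]|[]] //.
rewrite S1E Rintegral_setU//;
  [|by rewrite -S1E|by apply/disj_setPS; rewrite PreNeg].
rewrite [in RHS]NPreE Rintegral_setU//;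
  [|by rewrite -NPreE|by apply/disj_setPS; rewrite NegZ].
rewrite -addrA; congr (_ + (_ + _)).
have [[om0 ->]|[-> zZ]] := omega_cases hB; last first.
  rewrite Rintegral_set0 oppr0 /Rintegral null_set_integral//.
  by apply/measurable_EFinP; exact: (mf Z).
have Z0 : \int[sigma]_(t in Z) f t = 0.
  rewrite (@eq_Rintegral _ _ _ _ _ (fun=> 0));
    first by rewrite Rintegral_cst// mul0r.
  by move=> t; rewrite inE => -[_ ->]; rewrite /f r0// mul0r.
by rewrite Z0 oppr0.
Qed.

(** Undoing the reflection replaces l by -l and keeps s; the numerator l - i omega becomes -(l + i
    omega), and its sign cancels the minus in front of the integral against [reflected sigma]. *)
Lemma psi_rhsE : (sigma S1 < +oo)%E -> psi_rhs sigma omega B =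
  (\int[sigma]_(t in Pre) (t / (2 * s t)) +
    \int[sigma]_(t in NPre) (t / (2 * s t)))
  +i* (\int[sigma]_(t in Pre) (omega / (2 * s t))
       + \int[sigma]_(t in NPre) (omega / (2 * s t))).
Proof.
move=> S1oo; have NPoo : (sigma NPre < +oo)%E.
  apply: le_lt_trans S1oo; apply: le_measure; rewrite ?inE//.
  by rewrite NPreE => t [[]|[]].
have refl (r : R -> R) : measurable_fun (setT : set TR) r ->
    (forall t, `|r t| <= s t) ->
    \int[reflected sigma]_(t in Pre) (r t / (2 * s t)) =
    \int[sigma]_(t in NPre) (r (- t) / (2 * s t)).
  move=> mr rs; rewrite /Rintegral /reflected.
  have mf : measurable_fun (setT : set TR) (fun t => (r t / (2 * s t))%:E).
    by apply/measurable_EFinP/measurable_funM => //; exact: measurable_inv2s.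
  have mN : measurable_fun (setT : set TR) (-%R : TR -> TR).
    exact: (measurable_funN (@measurable_id _ TR setT)).
  rewrite (integral_pushforward mN mf)//.
    by congr fine; apply: eq_integral => t _ /=; rewrite s_ofN.
  have rN : measurable_fun (setT : set TR) (fun t => r (- t)).
    exact: (measurableT_comp mr mN).
  have iN : sigma.-integrable NPre (fun t => (r (- t) / (2 * s t))%:E).
    apply: (@integrable_ae_bounded _ _ TR sigma NPre
      (fun t => r (- t) / (2 * s t)) 1) => //.
      by apply: measurable_funTS; apply: measurable_funM => //;
        exact: measurable_inv2s.
    apply: aeW => t; apply: (@norm_div2s_le1 _ _ (fun t => r (- t))) => u.
    by rewrite (le_trans (rs _))// s_ofN.
  by apply: eq_integrable iN => // t _ /=; rewrite s_ofN.
have cE (a b c : R) : (a +i* b) / c%:C = (a / c) +i* (b / c).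
  rewrite -fmorphV; apply/eqP; rewrite eq_complex Re_mulc Im_mulc/=.
  by rewrite !mulr0 subr0 add0r !eqxx.
have neg (r : R -> R) : measurable_fun (setT : set TR) r ->
  (forall t, `|r t| <= s t) ->
    - (\int[sigma]_(t in NPre) (- r t / (2 * s t))) =
    \int[sigma]_(t in NPre) (r t / (2 * s t)).
  move=> mr rs;
    rewrite (@eq_Rintegral _ TR R sigma NPre (fun t => -1 * (r t / (2 * s t)))).
    rewrite RintegralZl ?mulN1r ?opprK//.
    apply: (@integrable_ae_bounded _ _ TR sigma NPre (fun t => r t / (2 * s t))
      1) => //.
      by apply: measurable_funTS; apply: measurable_funM => //;
        exact: measurable_inv2s.
    by apply: aeW => t; exact: norm_div2s_le1.
  by move=> t _; rewrite mulN1r mulNr.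
rewrite /psi_rhs.
rewrite (_ : (fun l => _) = (fun l => (l / (2 * s l)) +i* (omega / (2 * s l))));
  last first.
  by apply/funext => t; rewrite cE.
rewrite (_ : (fun l => (l -i* _) / _) =
  (fun l => (l / (2 * s l)) +i* (- omega / (2 * s l)))); last first.
  by apply/funext => t; rewrite cE.
rewrite /cintegral; apply/eqP; rewrite eq_complex/=; apply/andP;
  split; apply/eqP; congr (_ + _).
- by rewrite (refl id)// -?(neg id)// => t; exact: s_of_ge_norm.
- by rewrite (refl (fun=> - omega))// -?(neg (fun=> omega))// => t;
  rewrite ?normrN; exact: s_of_geN.
Qed.

End fold_reflection.

(** For real l, z^2 = l^2 + omega^2 would be a nonnegative real, forcing z to be real. *)
Lemma Im_sqrt_neq0 (R : realType) (omega : R) (z l : R[i]) :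
  complex.Im z != 0 -> l ^+ 2 = z ^+ 2 + (0 +i* omega) ^+ 2 ->
    complex.Im l != 0.
Proof.
case: z => x y; case: l => a b /= y0 /eqP;
  rewrite eq_complex/= => /andP[/eqP re /eqP im].
apply: contra_neq y0 => b0; move: re im;
  rewrite b0 !(mul0r, mulr0, subr0, add0r, addr0).
move=> re im.
have : x * y = 0 by rewrite mulrC in im; lra.
move=> /eqP; rewrite mulf_eq0 => /orP[/eqP x0|/eqP//].
move: re; rewrite x0 mul0r => re.
by have := sqr_ge0 a; have := sqr_ge0 omega; have := sqr_ge0 y;
  rewrite !expr2 => h1 h2 h3;
  apply/eqP; rewrite -sqrf_eq0 expr2; apply/eqP; lra.
Qed.

(** * Conclusion: support, formulas and endpoint for the given spectral pair *)

Section spectral_measures.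
Variable R : realType.
Notation TR := (measurableTypeR R).
Notation Re := complex.Re.
Notation Im := complex.Im.
Variables (q : R -> R) (alpha : option R) (omega : R).
Variables (sigma nu : {measure set TR -> \bar R}) (psi : R -> R[i]).
Hypotheses (q_bounded : exists K : R, forall x : R, 0 < x -> `|q x| <= K)
  (sigma_spectral : is_spectral_measure q alpha sigma)
  (nu_psi_spectral : is_spectral_pair (fun x => q x +i* omega)
     (omap (fun a : R => a%:C) alpha) nu psi).
Let s (t : R) := s_of omega t.

Lemma poisson_identities (x y : R) : 0 < y ->
  [/\ [/\ nu.-integrable setT (fun t => (poisson x y t)%:E),
        sigma.-integrable setT
          (fun t => (2^-1 * (poisson x y (s t) + poisson x y (- s t)))%:E) &
        \int[nu]_t poisson x y t =
        \int[sigma]_t (2^-1 * (poisson x y (s t) + poisson x y (- s t)))],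
      [/\ nu.-integrable setT (fun t => (poisson x y t * Re (psi t))%:E),
        sigma.-integrable setT
          (fun t => (t / (2 * s t) *
            (poisson x y (s t) - poisson x y (- s t)))%:E) &
        \int[nu]_t (poisson x y t * Re (psi t)) =
        \int[sigma]_t
          (t / (2 * s t) * (poisson x y (s t) - poisson x y (- s t)))] &
      [/\ nu.-integrable setT (fun t => (poisson x y t * Im (psi t))%:E),
        sigma.-integrable setT
          (fun t => (omega / (2 * s t) *
            (poisson x y (s t) - poisson x y (- s t)))%:E) &
        \int[nu]_t (poisson x y t * Im (psi t)) =
        \int[sigma]_t
          (omega / (2 * s t) * (poisson x y (s t) - poisson x y (- s t)))]].
Proof.
move=> y0; pose z := x +i* y; have z0 : Im z != 0 by rewrite gt_eqF.
have zn0 : z != 0 by apply: contra_neq z0 => ->.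
(* Either root serves: [M_of_m] is unchanged when l changes sign and m(l), m(-l) are exchanged. *)
pose l := sqrtc (z ^+ 2 + (0 +i* omega) ^+ 2).
have lz : l ^+ 2 = z ^+ 2 + (0 +i* omega) ^+ 2 by exact: sqr_sqrtc.
have l0 := Im_sqrt_neq0 z0 lz.
have ln0 : l != 0 by apply: contra_neq l0 => ->.
have Nl0 : Im (- l) != 0 by case: (l) l0 => a b /=; rewrite oppr_eq0.
have [m [hm hsigma mE]] := sigma_spectral.
have [_ mpsi _ psi1 [M [hM hnu ME]]] := nu_psi_spectral.
have MmE := is_M_valueE q_bounded zn0 ln0 lz (hm l l0) (hm _ Nl0) (hM z z0).
have [a1 b1] := M_of_m_diag z0 l0 lz hsigma (mE l l0) (mE _ Nl0).
have [a2 b2] := M_of_m_sym z0 l0 lz hsigma (mE l l0) (mE _ Nl0).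
have [a3 b3] := M_of_m_skew z0 l0 lz hsigma (mE l l0) (mE _ Nl0).
have [c1 d1] := spectral_pair_diag hnu z0 (ME z z0).
have [c2 d2] := spectral_pair_sym hnu mpsi psi1 z0 (ME z z0).
have [c3 d3] := spectral_pair_skew hnu mpsi psi1 z0 (ME z z0).
have two0 : (2 : R) != 0 by [].
rewrite MmE in d1 d2 d3; split; split => //.
- exact: etrans (esym d1) b1.
- by apply: (mulfI two0); exact: etrans (esym d2) b2.
- by apply: (mulfI two0); exact: etrans (esym d3) b3.
Qed.

Let hnu : herglotz_measure nu.
Proof. by have [_ _ _ _ [M []]] := nu_psi_spectral. Qed.

Let diag (x y : R) : 0 < y ->
  [/\ nu.-integrable setT (fun t => (poisson x y t)%:E),
    sigma.-integrable setT
      (fun t => (2^-1 * (poisson x y (s t) + poisson x y (- s t)))%:E) &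
    \int[nu]_t poisson x y t =
    \int[sigma]_t (2^-1 * (poisson x y (s t) + poisson x y (- s t)))].
Proof. by move=> /(poisson_identities x)[]. Qed.

Let mRe : measurable_fun (setT : set TR) (fun t => Re (psi t)).
Proof. by have [_ []] := nu_psi_spectral. Qed.

Let mIm : measurable_fun (setT : set TR) (fun t => Im (psi t)).
Proof. by have [_ []] := nu_psi_spectral. Qed.

Let psi1 : {ae nu, forall t : R, `|psi t| <= 1}.
Proof. by have [] := nu_psi_spectral. Qed.

(** [offdiag_transfer] is used with r(t) = t for Re psi and with r constant equal to omega for Im
    psi; s dominates both in absolute value. *)
Lemma cintegral_psi (A : set TR) : measurable A -> (nu A < +oo)%E ->
  cintegral nu A psi =
  (\int[sigma]_(t in s @^-1` A) (t / (2 * s t))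
    - \int[sigma]_(t in (fun t => - s t) @^-1` A) (t / (2 * s t)))
  +i* (\int[sigma]_(t in s @^-1` A) (omega / (2 * s t))
    - \int[sigma]_(t in (fun t => - s t) @^-1` A) (omega / (2 * s t))).
Proof.
move=> mA nuA; rewrite /cintegral; congr (_ +i* _).
- apply: (offdiag_transfer hnu diag mRe (r := id)) => //.
  + by apply: ae_imply psi1 => t; exact: norm_Re_le1.
  + by move=> t; exact: s_of_ge_norm.
  + by move=> x y y0; have [] := poisson_identities x y0.
- apply: (offdiag_transfer hnu diag mIm (r := fun=> omega)) => //.
  + by apply: ae_imply psi1 => t; exact: norm_Im_le1.
  + by move=> t; exact: s_of_geN.
  + by move=> x y y0; have [] := poisson_identities x y0.
Qed.

Lemma nu_support : nu (~` (`]-oo, - `|omega| ] `|` `[ `|omega|, +oo[)) = 0%E.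
Proof.
rewrite (nu_transfer hnu diag); last by apply: measurableC; exact: measurableU.
rewrite (_ : _ @^-1` _ = set0); last first.
  apply/seteqP; split => t //=; apply; right.
  by rewrite in_itv/= andbT s_of_geN.
rewrite (_ : _ @^-1` _ = set0); last first.
  apply/seteqP; split => t //=; apply; left.
  by rewrite in_itv/= lerN2 s_of_geN.
by rewrite !measure0 !mule0 adde0.
Qed.

Lemma nu_psi_formulas (B : set TR) : measurable B -> B `<=` `[ `|omega|, +oo[ ->
  (B `|omega| -> omega = 0 \/ sigma [set 0] = 0%E) ->
  nu B = nu_rhs sigma omega B /\
  ((nu B < +oo)%E -> cintegral nu B psi = psi_rhs sigma omega B).
Proof.
move=> mB Bo hB; split; first by rewrite (nu_transfer hnu diag)// nu_rhsE.
move=> nuB; have [S1oo _] := sigma_preimage_lty hnu diag mB nuB.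
rewrite cintegral_psi// psi_rhsE// (fold_integral mB Bo hB (r := id))//;
  last first.
  by move=> t; exact: s_of_ge_norm.
rewrite (fold_integral mB Bo hB (r := fun=> omega))// => t; exact: s_of_geN.
Qed.

(** Only t = 0 has s = |omega|, and -s never takes this positive value, so nu receives the atom of
    sigma at 0 with weight 1/2, while the right-hand sides count it in sigma and again in
    [reflected sigma]. *)
Lemma nu_psi_endpoint : omega != 0 ->
  nu [set `|omega|] = ((2^-1)%:E * nu_rhs sigma omega [set `|omega|%R])%E /\
  cintegral nu [set `|omega|] psi = 2^-1 * psi_rhs sigma omega [set `|omega|].
Proof.
move=> om0; have s_eq t : s t = `|omega| -> t = 0.
  move=> /(congr1 (fun u => u ^+ 2)); rewrite sqr_s_of real_normK ?num_real//.
  by move=> h; apply/eqP; rewrite -sqrf_eq0; apply/eqP; lra.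
have s0 : s 0 = `|omega| by rewrite /s /s_of expr0n add0r sqrtr_sqr.
have S1E : s @^-1` [set `|omega|] = [set 0].
  by apply/seteqP; split => t /=; [exact: s_eq|move=> ->].
have S2E : (fun t => - s t) @^-1` [set `|omega|] = set0.
  apply/seteqP; split => t //= h; have := s_of_ge0 omega t.
  by rewrite -/(s t) -oppr_le0 h leNgt normr_gt0 om0.
have PreE : s_preimage omega [set `|omega|] = [set 0].
  by apply/seteqP; split => t /=; [move=> [_]; exact: s_eq|move=> ->].
have NPreE : (-%R : TR -> TR) @^-1` [set 0] = [set 0].
  by apply/seteqP; split => t /= => [/eqP|->];
    rewrite ?oppr0// oppr_eq0 => /eqP.
have nuoo : (nu [set `|omega|%R] < +oo)%E.
  have := herglotz_measure_itv_lty `|omega| hnu.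
  apply: le_lt_trans; apply: le_measure; rewrite ?inE// => _ ->.
  by rewrite /= in_itv/= lexx andbT; move: om0; rewrite -normr_gt0; lra.
have [S1oo _] := sigma_preimage_lty hnu diag (measurable_set1 `|omega|) nuoo.
split.
  rewrite (nu_transfer hnu diag)// S1E S2E measure0 mule0 adde0.
  rewrite /nu_rhs /reflected /pushforward PreE NPreE.
  have S1fin : sigma [set 0%R] \is a fin_num by rewrite ge0_fin_numE// -S1E.
  by rewrite -(fineK S1fin) -EFinD -!EFinM; congr EFin; lra.
rewrite cintegral_psi// psi_rhsE//.
rewrite PreE NPreE S1E S2E !Rintegral_set0 !subr0.
have -> : (2^-1 : R[i]) = (2^-1)%:C by rewrite fmorphV rmorph_nat.
by apply/eqP; rewrite eq_complex Re_mulc Im_mulc/=; apply/andP;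
  split; apply/eqP; lra.
Qed.

End spectral_measures.

Theorem theorem1p8 (R : realType) (q : R -> R) (alpha : option R) (omega : R)
    (sigma nu : {measure set (measurableTypeR R) -> \bar R}) (psi : R -> R[i])
    (q_meas : measurable_fun (`]0, +oo[ : set (measurableTypeR R)) q)
    (q_bounded : exists K : R, forall x : R, 0 < x -> `|q x| <= K)
    (sigma_spectral : is_spectral_measure q alpha sigma)
    (nu_psi_spectral : is_spectral_pair (fun x => q x +i* omega)
       (omap (fun a : R => a%:C) alpha) nu psi) :
  [/\ nu (~` (`]-oo, - `|omega| ] `|` `[ `|omega|, +oo[)) = 0%E,
      (* The formulas, as identities of measures on [|omega|, oo). *)
      (forall B : set (measurableTypeR R), measurable B ->
         B `<=` `[ `|omega|, +oo[ ->
         (B `|omega| -> omega = 0 \/ sigma [set 0] = 0%E) ->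
         nu B = nu_rhs sigma omega B /\
         ((nu B < +oo)%E -> cintegral nu B psi = psi_rhs sigma omega B)) &
      (* At the endpoint s = |omega| > 0, an atom of sigma at l = 0 is shared
         equally between the two points s and - s. *)
      (omega != 0 ->
         nu [set `|omega|] =
           ((2^-1)%:E * nu_rhs sigma omega [set `|omega|%R])%E /\
         cintegral nu [set `|omega|] psi =
           2^-1 * psi_rhs sigma omega [set `|omega|])].
Proof.
split.
- exact: nu_support q_bounded sigma_spectral nu_psi_spectral.
- move=> B mB Bomega hB.
  exact (nu_psi_formulas q_bounded sigma_spectral nu_psi_spectral mB Bomega hB).
- exact: nu_psi_endpoint q_bounded sigma_spectral nu_psi_spectral.
Qed.
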